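(* Let $(\mathcal{X},d_\mathcal{X})$, $(\mathcal{Y}_k,d_{\mathcal{Y}_k})$, $k=1,\dots,K$, be compact metric spaces, $c_k:\mathcal{X}\times\mathcal{Y}_k\to\mathbb{R}_+$ continuous, and assume that for every $Y=(y_1,\dots,y_K)\in\mathcal{Y}:=\mathcal{Y}_1\times\cdots\times\mathcal{Y}_K$ the function $x\mapsto\sum_k c_k(x,y_k)$ has a unique minimiser $B(Y)$ on $\mathcal{X}$, and that there exist $x\in\mathcal{X}$, $Y\in\mathcal{Y}$ with $x\ne B(Y)$. Fix $\nu_k\in\mathcal{P}(\mathcal{Y}_k)$. For any $\mu_0\in\mathcal{P}(\mathcal{X})$, let $(\mu_t)_{t\in\mathbb{N}}$ be any sequence with $\mu_{t+1}\in G(\mu_t)$ for all $t$. Then $(\mu_t)$ has weakly converging subsequences, and any weakly converging subsequence converges to some $\mu\in\mathcal{P}(\mathcal{X})$ satisfying $\mu\in G(\mu)$.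
   Context: $\mathcal{P}(S)$ denotes Borel probability measures with the weak topology. For $\mu\in\mathcal{P}(\mathcal{X})$, $\Pi^*_{c_k}(\mu,\nu_k)$ is the set of optimal couplings for $\inf_{\pi\in\Pi(\mu,\nu_k)}\int c_k\,\mathrm{d}\pi$. $\Gamma(\mu)$ is the set of $\gamma\in\mathcal{P}(\mathcal{X}\times\mathcal{Y}_1\times\cdots\times\mathcal{Y}_K)$ whose marginal $\gamma_{0,k}$ on $\mathcal{X}\times\mathcal{Y}_k$ lies in $\Pi^*_{c_k}(\mu,\nu_k)$ for each $k$, and $G(\mu):=\{B\#\gamma_{1,\dots,K}:\gamma\in\Gamma(\mu)\}$, where $\gamma_{1,\dots,K}$ is the marginal of $\gamma$ on $\mathcal{Y}$ and $\#$ denotes push-forward. *)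

(* Defs.v *)
From HB Require Import structures.
From mathcomp Require Import all_boot all_order all_algebra.
From mathcomp Require Import all_classical all_reals all_analysis.
Set Implicit Arguments. Unset Strict Implicit. Unset Printing Implicit Defensive.
Import Order.TTheory GRing.Theory Num.Theory numFieldNormedType.Exports.
Local Open Scope classical_set_scope.
Local Open Scope ring_scope.

(* Pointed instances needed so that the finite product Y_1 x ... x Y_K
   (with its product topology) and binary products are pointed topological
   spaces. *)
HB.instance Definition _ (I : Type) (T : I -> ptopologicalType) :=
  Pointed.copy (prod_topology T) (forall i, T i).
HB.instance Definition _ (X Y : ptopologicalType) := Pointed.on (X * Y)%type.

Notation borel T := (g_sigma_algebraType (@open T)).

Section OT.
Context (R : realType).
Local Open Scope ereal_scope.

Definition weak_cvg (X : ptopologicalType)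
  (m : nat -> probability (borel X) R) (l : probability (borel X) R) : Prop :=
  forall f : X -> R, continuous f -> (exists M : R, forall x, (`|f x| <= M)%R) ->
    (fun n => \int[m n]_x (f x)%:E) @ \oo --> \int[l]_x (f x)%:E.

Definition has_marginals (X Y : ptopologicalType)
  (pi : set (borel (X * Y)%type) -> \bar R)
  (mu : probability (borel X) R) (nu : probability (borel Y) R) : Prop :=
  (forall A : set (borel X), measurable A ->
     pushforward pi (fun z : X * Y => (z.1 : borel X)) A = mu A) /\
  (forall A : set (borel Y), measurable A ->
     pushforward pi (fun z : X * Y => (z.2 : borel Y)) A = nu A).

Definition couplings (X Y : ptopologicalType)
  (mu : probability (borel X) R) (nu : probability (borel Y) R)
  (pi : probability (borel (X * Y)%type) R) : Prop :=
  has_marginals pi mu nu.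

Definition optimal_coupling (X Y : ptopologicalType) (c : X * Y -> R)
  (mu : probability (borel X) R) (nu : probability (borel Y) R)
  (pi0 : set (borel (X * Y)%type) -> \bar R) : Prop :=
  has_marginals pi0 mu nu /\
  forall pi : probability (borel (X * Y)%type) R, couplings mu nu pi ->
    \int[pi0]_z (c z)%:E <= \int[pi]_z (c z)%:E.

Definition Gamma (K : nat) (X : ptopologicalType) (Y : 'I_K -> ptopologicalType)
  (c : forall k, X * Y k -> R) (nu : forall k, probability (borel (Y k)) R)
  (mu : probability (borel X) R)
  (gamma : probability (borel (X * (prod_topology Y))%type) R) : Prop :=
  forall k : 'I_K, optimal_coupling (c k) mu (nu k)
    (pushforward gamma (fun z : X * (prod_topology Y) => ((z.1, z.2 k) : borel (X * Y k)%type))).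

Definition inG (K : nat) (X : ptopologicalType) (Y : 'I_K -> ptopologicalType)
  (c : forall k, X * Y k -> R) (B : (prod_topology Y) -> X)
  (nu : forall k, probability (borel (Y k)) R)
  (mu mu' : probability (borel X) R) : Prop :=
  exists gamma : probability (borel (X * (prod_topology Y))%type) R,
    Gamma c nu mu gamma /\
    forall A : set (borel X), measurable A ->
      mu' A = pushforward (pushforward gamma
        (fun z : X * (prod_topology Y) => (z.2 : borel (prod_topology Y))))
        (fun y : prod_topology Y => (B y : borel X)) A.

End OT.

(* Main.v *)
Require Import Defs.
From HB Require Import structures.
From mathcomp Require Import all_boot all_order all_algebra.
From mathcomp Require Import all_classical all_reals all_analysis.
From mathcomp Require Import measurable_realfun lra.
Set Implicit Arguments.
Unset Strict Implicit.
Unset Printing Implicit Defensive.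
Import Order.TTheory GRing.Theory Num.Theory numFieldNormedType.Exports.
Local Open Scope classical_set_scope.
Local Open Scope ring_scope.

(** Let [S t] be the sum over [k] of the optimal costs between [mu t] and
    [nu k], and let [g t] realise them all.  Replacing [x] by [B y] in [g t]
    lowers the integrated total cost and produces couplings of [mu t.+1] with
    the [nu k], so [S t.+1 <= \int sum_k c_k(B y, y_k) dg_t <= S t] and both
    bounds converge to the same limit.  A limit [gam] of the [g (phi n)] along
    an ultrafilter has first marginal [l] and is optimal for each [k], because
    a coupling of [l] and [nu k] can be perturbed into couplings of
    [mu (phi n)] and [nu k] of almost the same cost.  The two bounds agree on
    [gam], hence [x = B y] holds [gam]-almost everywhere and [l] is the
    push-forward of [gam] under [B].

    Limits are taken on the side of normalised positive functionals on
    continuous functions, and brought back to measures by Riesz'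
    representation theorem. *)

(** * Positive functionals and Daniell's outer measure *)

(** Functionals are preferred to measures because a pointwise limit of positive normalised
    functionals is again one, whereas setwise limits of measures lose countable additivity. The
    ultrafilter makes the limits of all test functions exist at once; a subsequence is built only
    where the statement asks for one. On a compact metric space continuous functions determine Borel
    probabilities, so every marginal condition becomes an identity between integrals of continuous
    functions. The obstacle is the stability of optimality: a competitor for the limit has first
    marginal [l], not [mu (phi n)]. A finite partition of unity stands in for disintegration when
    this marginal is corrected. Passing to the limit in integrals of functions of [B y] requires [B]
    to be continuous; this follows from uniqueness of the minimiser and compactness. The hypothesis
    [nontriv] excludes [K = 0], where [Gamma] would impose no condition at all. *)

Section RealContinuity.
Context {R : realType} {T : topologicalType}.
Implicit Types f g : T -> R.

Lemma contC (a : R) : continuous (fun _ : T => a).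
Proof. by move=> x; exact: cvg_cst. Qed.

Lemma contD f g : continuous f -> continuous g -> continuous (fun x => f x + g x).
Proof. by move=> cf cg x; apply: cvgD; [exact: cf|exact: cg]. Qed.

Lemma contN f : continuous f -> continuous (fun x => - f x).
Proof. by move=> cf x; apply: cvgN; exact: cf. Qed.

Lemma contB f g : continuous f -> continuous g -> continuous (fun x => f x - g x).
Proof. by move=> cf cg; apply: contD => //; exact: contN. Qed.

Lemma contM f g : continuous f -> continuous g -> continuous (fun x => f x * g x).
Proof. by move=> cf cg x; apply: cvgM; [exact: cf|exact: cg]. Qed.

Lemma cont_min f g : continuous f -> continuous g ->
  continuous (fun x => Num.min (f x) (g x)).
Proof. by move=> cf cg x; apply: continuous_min; [exact: cf|exact: cg]. Qed.

Lemma cont_max f g : continuous f -> continuous g ->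
  continuous (fun x => Num.max (f x) (g x)).
Proof. by move=> cf cg x; apply: continuous_max; [exact: cf|exact: cg]. Qed.

Lemma cont_sum (I : Type) (r : seq I) (f : I -> T -> R) :
  (forall i, continuous (f i)) -> continuous (fun x => \sum_(i <- r) f i x).
Proof.
move=> cf; elim: r => [|i r ih].
  by under eq_fun do rewrite big_nil; exact: contC.
by under eq_fun do rewrite big_cons; exact: contD.
Qed.

End RealContinuity.
Arguments contC {R T} a.

Lemma cont_comp {S T U : topologicalType} (g : T -> U) (f : S -> T) :
  continuous g -> continuous f -> continuous (fun x => g (f x)).
Proof. by move=> cg cf x; apply: (@continuous_comp _ _ _ f g); [exact: cf|exact: cg]. Qed.

Ltac cont := lazymatch goal with
  | |- continuous (fun x => @?f x + @?g x) => refine (@contD _ _ f g _ _); cont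
  | |- continuous (fun x => - @?f x) => refine (@contN _ _ f _); cont
  | |- continuous (fun x => @?f x * @?g x) => refine (@contM _ _ f g _ _); cont
  | |- continuous (fun x => Num.min (@?f x) (@?g x)) => refine (@cont_min _ _ f g _ _); cont
  | |- continuous (fun x => Num.max (@?f x) (@?g x)) => refine (@cont_max _ _ f g _ _); cont
  | |- continuous (fun=> ?a) => exact: contC
  | |- _ => first [assumption | match goal with H : _ |- _ => exact: H end]
  end.

Section CompactFunctions.
Context {R : realType} {T : ptopologicalType} (Tc : compact [set: T]).

Lemma compact_bounded_fun (f : T -> R) :
  continuous f -> exists2 M : R, 0 <= M & forall x, `|f x| <= M.
Proof.
move=> cf.
have ca : continuous (fun x => `|f x|) by move=> x; apply: cvg_norm; exact: cf.
have [||c _ H] := @compact_EVT_max T R (fun x => `|f x|) [set: T] _ Tc.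
- by exists point.
- by apply: continuous_subspaceT; exact: ca.
by exists `|f c| => // x; apply: H; rewrite inE.
Qed.

End CompactFunctions.

(** * Normalised positive linear functionals *)

Section State.
Context {R : realType} {T : ptopologicalType}.
Implicit Types (f g : T -> R) (L : (T -> R) -> R).

(** Kept on the unbundled type [T -> R], each clause being guarded by continuity: expectations and
    ultrafilter limits are then states as they stand, and values at discontinuous functions do not
    matter. *)
Definition state L : Prop :=
  [/\ L (fun=> 1) = 1,
      forall f g, continuous f -> continuous g ->
        L (fun x => f x + g x) = L f + L g,
      forall a f, continuous f -> L (fun x => a * f x) = a * L f
    & forall f, continuous f -> (forall x, 0 <= f x) -> 0 <= L f].

Context {L} (SL : state L).

Lemma state1 : L (fun=> 1) = 1. Proof. by have [] := SL. Qed.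

Lemma stateD f g : continuous f -> continuous g ->
  L (fun x => f x + g x) = L f + L g.
Proof. by have [_ H _ _] := SL; exact: H. Qed.

Lemma stateZ a f : continuous f -> L (fun x => a * f x) = a * L f.
Proof. by have [_ _ H _] := SL; exact: H. Qed.

Lemma state_ge0 f : continuous f -> (forall x, 0 <= f x) -> 0 <= L f.
Proof. by have [_ _ _ H] := SL; exact: H. Qed.

Lemma stateC a : L (fun=> a) = a.
Proof.
by have := stateZ a (contC 1); rewrite state1 mulr1.
Qed.

Lemma stateN f : continuous f -> L (fun x => - f x) = - L f.
Proof.
move=> cf; rewrite -mulN1r -stateZ//; congr L; apply/funext => x.
by rewrite mulN1r.
Qed.

Lemma stateB f g : continuous f -> continuous g ->
  L (fun x => f x - g x) = L f - L g.
Proof. by move=> cf cg; rewrite stateD ?stateN//; exact: contN. Qed.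

Lemma state_le f g : continuous f -> continuous g ->
  (forall x, f x <= g x) -> L f <= L g.
Proof.
move=> cf cg fg; rewrite -subr_ge0 -stateB//; apply: state_ge0.
  exact: contB.
by move=> x; rewrite subr_ge0.
Qed.

Lemma state_sum (I : Type) (r : seq I) (f : I -> T -> R) :
  (forall i, continuous (f i)) ->
  L (fun x => \sum_(i <- r) f i x) = \sum_(i <- r) L (f i).
Proof.
move=> cf; elim: r => [|i r ih].
  by rewrite big_nil -[RHS](stateC 0); congr L; apply/funext => x; rewrite big_nil.
rewrite big_cons -ih -stateD//; last exact: cont_sum.
by congr L; apply/funext => x; rewrite big_cons.
Qed.

Lemma state_dist f g e : continuous f -> continuous g ->
  (forall x, `|f x - g x| <= e) -> `|L f - L g| <= e.
Proof.
move=> cf cg H; have cfg := contB cf cg.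
rewrite -stateB// ler_norml -[leLHS]stateC -[X in _ && (_ <= X)]stateC.
by apply/andP; split; (apply: state_le => [||x]; [by cont|by cont|]);
  have := H x; rewrite ler_norml => /andP[].
Qed.

Lemma state_norm f e : continuous f ->
  (forall x, `|f x| <= e) -> `|L f| <= e.
Proof.
move=> cf H; have := @state_dist f (fun=> 0) e cf (contC 0).
by rewrite stateC subr0; apply => x; rewrite subr0.
Qed.

End State.

Section RieszOuter.
Context {R : realType} {T : ptopologicalType} (Tc : compact [set: T]).
Context (L : (T -> R) -> R) (SL : state L).

(* Daniell's outer measure: [A] is dominated by the supremum of an increasing
   sequence of nonnegative continuous functions. *)
Definition dominates (A : set T) (g : nat -> T -> R) : Prop :=
  [/\ forall n, continuous (g n), forall n x, 0 <= g n x,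
      forall m n x, (m <= n)%N -> g m x <= g n x
    & forall x, A x -> exists n, 1 <= g n x].

Definition dominating_values (A : set T) : set R :=
  [set a | exists2 g, dominates A g & forall n, L (g n) <= a].

(** The infimum can be taken in [R]: the constant family 1 always dominates, and positivity of [L]
    bounds all values below by 0. *)
Definition riesz_outer (A : set T) : \bar R := (inf (dominating_values A))%:E.

Local Notation vals := dominating_values.
Local Notation mu := riesz_outer.

Let vals_ge0 A : lbound (vals A) 0.
Proof.
move=> a [g [cg g0 _ _] /(_ 0%N)]; apply: le_trans.
exact: (state_ge0 SL (cg 0%N) (g0 0%N)).
Qed.

Let vals1 A : vals A 1.
Proof.
exists (fun _ _ => 1) => [|n]; last by rewrite (state1 SL).
by split => // [n|x _]; [exact: contC|exists 0%N].
Qed.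

Let vals_inf A : has_inf (vals A).
Proof. by split; [exists 1|exists 0]. Qed.

Lemma riesz_outer_le A a : vals A a -> (mu A <= a%:E)%E.
Proof. by move=> Aa; rewrite lee_fin; apply: ge_inf => //; exists 0. Qed.

Let mu_lt A e : 0 < e -> exists2 a, vals A a & (a%:E < mu A + e%:E)%E.
Proof.
move=> e0; have [a Aa ae] := inf_adherent e0 (vals_inf A).
by exists a => //; rewrite -EFinD lte_fin.
Qed.

Let mu_ge0 A : (0 <= mu A)%E.
Proof. by rewrite lee_fin; apply: lb_le_inf => //; exists 1. Qed.

Let mu_homo A B : A `<=` B -> (mu A <= mu B)%E.
Proof.
move=> AB; rewrite lee_fin; apply: lb_le_inf; first by exists 1.
move=> a [g [cg g0 gm gB] ga]; rewrite -lee_fin; apply: riesz_outer_le.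
by exists g => //; split => // x /AB; exact: gB.
Qed.

Let mu0 : mu set0 = 0%E.
Proof.
apply/eqP; rewrite eq_le mu_ge0 andbT; apply: riesz_outer_le.
exists (fun _ _ => 0) => [|n]; last by rewrite (stateC SL).
by split => // n; exact: contC.
Qed.

Let mu_subadd : sigma_subadditive mu.
Proof.
move=> F; apply/lee_addgt0Pr => e e0.
have [->|Soo] := eqVneq (\sum_(i <oo) mu (F i))%E +oo%E.
  by rewrite addye// leey.
have part n : (\sum_(i < n) mu (F i) <= \sum_(i <oo) mu (F i))%E.
  rewrite -(big_mkord xpredT (fun i => mu (F i))).
  exact: nneseries_lim_ge.
have fS : (\sum_(i <oo) mu (F i))%E \is a fin_num.
  rewrite ge0_fin_numE ?lt_neqAle ?Soo ?leey//.
  by apply: nneseries_ge0.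
have pos i : 0 < e / 2 ^+ i.+1 by rewrite divr_gt0// exprn_gt0.
have /choice[a Ha] i : exists a, vals (F i) a /\ (a%:E < mu (F i) + (e / 2 ^+ i.+1)%:E)%E.
  by have [a ? ?] := mu_lt (F i) (pos i); exists a.
have /choice[g Hg] i : exists g, dominates (F i) g /\ forall n, L (g n) <= a i.
  by have [[g ? ?] _] := Ha i; exists g.
(* Truncating the sum at the index of the families keeps [G n] a finite sum, hence continuous, and
   still increasing in [n]. *)
pose G n x := \sum_(i < n) g i n x.
have cg i n : continuous (g i n) by have [[]] := Hg i.
have g0 i n x : 0 <= g i n x by have [[]] := Hg i.
have gm i m n x : (m <= n)%N -> g i m x <= g i n x.
  by move=> mn; have [[_ _ H _] _] := Hg i; exact: H.
rewrite -(fineK fS) -EFinD; apply: riesz_outer_le; exists G.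
  split.
  - by move=> n; apply: cont_sum.
  - by move=> n x; apply: sumr_ge0.
  - move=> m n x mn; rewrite /G -(big_mkord xpredT (fun i => g i m x)).
    rewrite -(big_mkord xpredT (fun i => g i n x)) [leRHS](big_cat_nat (n := m))//=.
    apply: ler_wpDr; first by apply: sumr_ge0.
    by apply: ler_sum => i _; exact: gm.
  - move=> x [i _ Fix].
    have [[_ _ _ /(_ _ Fix)[n gn]] _] := Hg i.
    (* The index must exceed [i] for the term [g i] to occur in the sum, and reach [n] for this term
       to be at least 1. *)
    exists (maxn i.+1 n).
    have lti : (i < maxn i.+1 n)%N by rewrite leq_max ltnSn.
    rewrite /G (bigD1 (Ordinal lti))//=.
    apply: ler_wpDr; first by apply: sumr_ge0.
    by apply: (le_trans gn); apply: gm; rewrite leq_maxr.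
move=> n; rewrite (state_sum SL)//.
apply: (@le_trans _ _ (\sum_(i < n) a i)).
  by apply: ler_sum => i _; have [_ H] := Hg i; exact: H.
apply: (@le_trans _ _ (\sum_(i < n) (fine (mu (F i)) + e / 2 ^+ i.+1))).
  by apply: ler_sum => i _; have [_ H] := Ha i; apply/ltW.
rewrite big_split/=; apply: lerD.
  by rewrite -lee_fin fineK// -sumEFin; exact: part.
suff -> : \sum_(i < n) e / 2 ^+ i.+1 = e - e / 2 ^+ n.
  by rewrite gerBl divr_ge0// ?ltW// exprn_gt0.
elim: n => [|n ih]; first by rewrite big_ord0 expr0 divr1 subrr.
rewrite big_ord_recr/= ih exprS invfM.
set t := (2 ^+ n)^-1; lra.
Qed.

HB.instance Definition _ := isOuterMeasure.Build R T riesz_outer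
  mu0 mu_ge0 mu_homo mu_subadd.

Definition riesz_outer_measure : {outer_measure set T -> \bar R} := riesz_outer.

(** Cozero sets are enough for all Borel sets: on a compact metric space every open set is one, by
    [open_cozero]. *)
Lemma cozero_caratheodory (g : T -> R) : continuous g -> (forall x, 0 <= g x) ->
  mu.-caratheodory [set x | 0 < g x].
Proof.
move=> cg g0; apply: le_caratheodory_measurable => A.
set U := [set x | 0 < g x].
rewrite -EFinD lee_fin; apply: lb_le_inf; first by exists 1.
move=> a [f [cf f0 fm fA] fa].
pose h m x := Num.min 1 (m%:R * g x).
have ch m : continuous (h m) by rewrite /h; cont.
have h0 m x : 0 <= h m x by rewrite /h le_min ler01/= mulr_ge0.
have h1 m x : h m x <= 1 by rewrite /h ge_min lexx.
have hm m n x : (m <= n)%N -> h m x <= h n x.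
  move=> mn; rewrite /h le_min ge_min lexx/= ge_min.
  by rewrite ler_wpM2r ?orbT// ler_nat.
have cfh m n : continuous (fun x => f m x * h n x) by cont.
have Lfh m n : (m <= n)%N -> L (fun x => f m x * h m x) <= L (fun x => f n x * h m x).
  by move=> mn; apply: (state_le SL) => [||x /=]; [by cont|by cont|]; apply: ler_wpM2r => //; exact: fm.
(* Split a family [f] dominating [A] into [f n * h m] and [f n * (1 - h m)],
   where [h m] increases to the indicator of [U]. *)
have HD m : (mu (A `&` ~` U) <= (a - L (fun x => f m x * h m x))%:E)%E.
  apply: riesz_outer_le; exists (fun n x => f n x * (1 - h m x)).
    split => [n|n x|p q x pq|x [Ax /negP]].
    - by cont.
    - by rewrite mulr_ge0// subr_ge0.
    - by apply: ler_wpM2r; [rewrite subr_ge0|exact: fm].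
    - rewrite -leNgt => gx; have [n fn] := fA x Ax; exists n.
      rewrite /h; have -> : g x = 0 by apply/eqP; rewrite eq_le gx g0.
      by rewrite mulr0 min_r// subr0 mulr1.
  have big n : (m <= n)%N -> L (fun x => f n x * (1 - h m x)) <=
      a - L (fun x => f m x * h m x).
    move=> mn.
    have -> : (fun x => f n x * (1 - h m x)) = (fun x => f n x - f n x * h m x).
      by apply/funext => x; rewrite mulrBr mulr1.
    by rewrite (stateB SL)//; apply: lerB => //; exact: Lfh.
  move=> n; apply: le_trans (big (maxn m n) (leq_maxl _ _)).
  apply: (state_le SL) => [||x /=]; [by cont|by cont|]; apply: ler_wpM2r; first by rewrite subr_ge0.
  by apply: fm; rewrite leq_maxr.
(* Outside [U] the index of [h] was fixed; inside, the diagonal family [f n * h n] is needed to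
   dominate every point, and [HD n] bounds each of its values. *)
rewrite -lerBrDr -lee_fin; apply: riesz_outer_le.
exists (fun n x => f n x * h n x).
  split => // [n x|m n x mn|x [Ax Ux]].
  - by rewrite mulr_ge0.
  - by apply: ler_pM => //; [exact: fm|exact: hm].
  - have [n fn] := fA x Ax.
    have [m mg] : exists m, 1 <= m%:R * g x.
      exists (Num.truncn (g x)^-1).+1.
      rewrite -ler_pdivrMr// div1r; apply/ltW/truncnS_gt.
    exists (maxn m n); rewrite -[leLHS](mulr1 1); apply: ler_pM => //.
      by apply: (le_trans fn); apply: fm; rewrite leq_maxr.
    apply: le_trans (hm m _ x (leq_maxl m n)).
    by rewrite /h le_min lexx.
by move=> n; have := HD n; rewrite lee_fin; lra.
Qed.

(** Dini's argument: an increasing family that reaches 1 at each point exceeds [1 - e] everywhere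
    from some index on, by compactness. *)
Lemma riesz_outerT : mu [set: T] = 1%E.
Proof.
apply/eqP; rewrite eq_le; apply/andP; split; first exact: riesz_outer_le.
rewrite lee_fin; apply: lb_le_inf; first by exists 1.
move=> a [g [cg g0 gm gT] ga]; apply/ler_addgt0Pr => e e0.
have [N _ HN] : \forall n \near \oo, forall x, [set: T] x -> 1 - e < g n x.
  apply: (compact_near_coveringP _).1 Tc _ _ (fun n x => 1 - e < g n x) _ _.
  move=> x _; have [n gn] := gT x I.
  have gx : 1 - e < g n x by apply: lt_le_trans gn; rewrite ltrBlDr ltrDl.
  have near1 : \forall y \near x, 1 - e < g n y.
    exact: (cg n x) _ (lt_nbhsr gx).
  exists ([set y | 1 - e < g n y], [set m | (n <= m)%N]) => /=.
    by split => //; exists n.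
  by move=> [y m] /= [gy nm]; apply: (lt_le_trans gy); exact: gm.
rewrite -lerBlDr; apply: le_trans (ga N).
rewrite -[leLHS](stateC SL); apply: (state_le SL) => //; first exact: contC.
by move=> x; apply/ltW/HN => /=.
Qed.

(** Chebyshev's inequality, witnessed by a constant family. The truncation at [h] on the right lets
    the bounds for successive layers add up in [riesz_representation]. *)
Lemma riesz_outer_layer (f : T -> R) (h : R) : continuous f -> (forall x, 0 <= f x) ->
  0 < h -> (h%:E * mu [set x | (h < f x)%R] <= (L (fun x => Num.min (f x) h))%:E)%E.
Proof.
move=> cf f0 h0; rewrite -lee_pdivlMl// -EFinM; apply: riesz_outer_le.
have cm : continuous (fun x => Num.min (f x) h) by cont.
exists (fun _ x => h^-1 * Num.min (f x) h) => [|_]; last by rewrite (stateZ SL).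
split => // [_|_ x|x /= hx]; first by cont.
- by rewrite mulr_ge0 ?invr_ge0 ?(ltW h0)// le_min f0 (ltW h0).
- by exists 0%N; rewrite (min_r (ltW hx)) mulVf ?gt_eqF.
Qed.

End RieszOuter.

(** * Borel probabilities on compact metric spaces *)

Section Distance.
Context {R : realType} {T : ptopologicalType}.

(* Continuity of each [d a] and separation of points already force [d] to
   induce the topology when [T] is compact, see [cdist_open]. *)
Definition cdist (d : T -> T -> R) : Prop :=
  [/\ forall x, d x x = 0, forall x y, d x y = d y x,
      forall x y z, d x z <= d x y + d y z, forall a, continuous (d a)
    & forall x y, d x y = 0 -> x = y].

Context (Tc : compact [set: T]) (d : T -> T -> R) (dd : cdist d).

Lemma cdist_ge0 x y : 0 <= d x y.
Proof.
have [dxx ds dt _ _] := dd.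
by have := dt x y x; rewrite dxx (ds y x) -mulr2n pmulrn_lge0.
Qed.

Lemma cdist_gt0 x y : x <> y -> 0 < d x y.
Proof.
have [_ _ _ _ d0] := dd.
by move=> xy; rewrite lt_neqAle cdist_ge0 andbT eq_sym; apply/eqP => /d0.
Qed.

(** The radius is the minimum of [d x] on the compact complement of [U], positive because [x] is not
    there. An empty complement has no minimum and is treated apart. *)
Lemma cdist_open (U : set T) x : open U -> U x ->
  exists2 e : R, 0 < e & forall y, d x y < e -> U y.
Proof.
move=> oU Ux; have [_ _ _ dc _] := dd.
have [U0|/set0P U0] := eqVneq (~` U) set0.
  exists 1 => // y _; apply: contrapT => nUy.
  by have : (~` U) y by []; rewrite U0.
have cU : compact (~` U).
  by apply: (@subclosed_compact _ _ [set: T]) => //; exact: open_closedC.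
have [|z zU H] := compact_EVT_min U0 cU (f := d x).
  by apply: continuous_subspaceT; exact: dc.
exists (d x z).
  by apply: cdist_gt0 => xz; move: zU; rewrite inE -xz.
move=> y xy; apply: contrapT => nUy.
by have := H y; rewrite inE leNgt xy => /(_ nUy).
Qed.

(* [g] is the distance to the complement of [U]. *)
Lemma open_cozero (U : set T) : open U ->
  exists g : T -> R, [/\ continuous g, forall x, 0 <= g x & U = [set x | 0 < g x]].
Proof.
move=> oU; have [dxx ds dt dc _] := dd.
have [U0|/set0P[z0 U0]] := eqVneq (~` U) set0.
  exists (fun=> 1); split => //; first exact: contC.
  rewrite eqEsubset; split => x //= _; apply: contrapT => nUy.
  by have : (~` U) x by []; rewrite U0.
pose S x := [set d x y | y in ~` U].
have S0 x : S x !=set0 by exists (d x z0); exists z0.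
have Sl x : lbound (S x) 0 by move=> _ [y _ <-]; exact: cdist_ge0.
pose g x := inf (S x).
have gP x a : lbound (S x) a -> a <= g x by exact: lb_le_inf (S0 x).
have g0 x : 0 <= g x by exact: gP (Sl x).
have gl x y : g x <= d x y + g y.
  rewrite -lerBlDl; apply: gP => _ [z Uz <-].
  rewrite lerBlDl; apply: le_trans (dt x y z).
  by apply: ge_inf; [exists 0|exists z].
exists g; split => //.
  move=> x; apply/cvgrPdist_lt => e e0.
  have near1 : \forall y \near x, d x y < e.
    have nb : \forall r \near nbhs (d x x), r < e by apply: lt_nbhsl; rewrite dxx.
    exact: (dc x x) _ nb.
  apply: filterS near1 => y xy; apply: le_lt_trans xy.
  rewrite ler_norml; apply/andP; split.
    by rewrite lerBrDr addrC lerBlDr addrC ds.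
  by rewrite lerBlDr.
rewrite eqEsubset; split => x /=.
  move=> Ux; have [e e0 He] := cdist_open oU Ux.
  apply: (lt_le_trans e0); apply: gP => _ [y Uy <-].
  by rewrite leNgt; apply/negP => /He.
move=> gx; apply: contrapT => nUx; move: gx; apply/negP; rewrite -leNgt.
by rewrite -(dxx x); apply: ge_inf; [exists 0|exists x].
Qed.

End Distance.

Section ContinuousBorel.
Context {R : realType}.

Lemma continuous_borel (S T : ptopologicalType) (h : S -> T) : continuous h ->
  measurable_fun [set: borel S] (h : borel S -> borel T).
Proof.
move=> ch; apply: (@measurability _ _ (borel S) (borel T) _ _ (@open T)) => // _ [U oU <-].
rewrite setTI; apply: sub_sigma_algebra => /=.
by apply: open_comp => // x _; exact: ch.
Qed.

Lemma continuous_borelR (T : ptopologicalType) (f : T -> R) : continuous f ->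
  measurable_fun [set: borel T] (f : borel T -> R).
Proof.
move=> cf; apply: (measurability _ (measurable_realfun.RGenOInfty.measurableE R)) => //.
move=> _ [_ [a ->] <-]; rewrite setTI; apply: sub_sigma_algebra => /=.
apply: open_comp; last exact: rray_open.
by move=> x _; exact: cf.
Qed.

Lemma continuous_borelE (T : ptopologicalType) (f : T -> R) : continuous f ->
  measurable_fun [set: borel T] (EFin \o (f : borel T -> R)).
Proof. by move=> cf; apply/measurable_EFinP; exact: continuous_borelR. Qed.

End ContinuousBorel.

Section Expectation.
Context {R : realType} {T : ptopologicalType} (Tc : compact [set: T]).
Implicit Types (P Q : probability (borel T) R) (f : T -> R).

Lemma continuous_integrable P f : continuous f ->
  P.-integrable [set: borel T] (EFin \o (f : borel T -> R)).
Proof.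
move=> cf; apply: measurable_bounded_integrable => //.
- by apply: (le_lt_trans (probability_le1 P measurableT)); exact: ltry.
- exact: continuous_borelR.
- have [M M0 fM] := compact_bounded_fun Tc cf.
  exists M; split; first exact: num_real.
  by move=> x Mx y _ /=; apply: (le_trans (fM y)); exact: ltW.
Qed.

Lemma EFin_expectation P f : continuous f ->
  (\int[P]_x (f x)%:E)%E = (\int[P]_x f x)%:E.
Proof.
move=> cf; rewrite /Rintegral fineK//.
exact: integrable_fin_num (continuous_integrable P cf).
Qed.

Lemma expectation_state P : state (fun f : T -> R => \int[P]_x f x).
Proof.
split.
- rewrite Rintegral_cst// mul1r -[RHS]/(fine 1%E); congr fine.
  exact: probability_setT.
- move=> f g cf cg; rewrite RintegralD//; exact: continuous_integrable.
- move=> a f cf; rewrite RintegralZl//; exact: continuous_integrable.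
- by move=> f cf f0; apply: Rintegral_ge0.
Qed.

(** Open sets are stable under intersection and generate the Borel sets, so agreement on them
    suffices. For [U = {g > 0}] it comes from squeezing [min 1 (n g)] between the indicators of
    [{n g > 1}] and of [U], then letting [n] grow. *)
Lemma probability_eq (d : T -> T -> R) P Q : cdist d ->
  (forall f, continuous f -> \int[P]_x f x = \int[Q]_x f x) ->
  forall A : set (borel T), measurable A -> P A = Q A.
Proof.
move=> dd PQ A mA.
(* Stated for an arbitrary pair, so that exchanging the two probabilities yields the converse
   inequality. *)
have half (P' Q' : probability (borel T) R) (U : set (borel T)) :
    (forall f, continuous f -> \int[P']_x f x = \int[Q']_x f x) ->
    @open T U -> (P' U <= Q' U)%E.
  move=> PQ' oU; have [g [cg g0 Ug]] := open_cozero Tc dd oU.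
  have mo (V : set T) : open V -> measurable (V : set (borel T)).
    by move=> oV; exact: sub_sigma_algebra.
  pose V n : set (borel T) := [set x : T | 1 < n%:R * g x].
  have oV n : @open T (V n).
    have cng : continuous (fun x : T => n%:R * g x) by cont.
    rewrite [V n](_ : _ = (fun x : T => n%:R * g x) @^-1` `]1, +oo[%classic).
      by apply: open_comp; [move=> x _; exact: cng|exact: rray_open].
    by apply/seteqP; split => x /=; rewrite in_itv/= andbT.
  have Vm : {homo V : n m / (n <= m)%N >-> (n <= m)%O}.
    move=> n m nm; apply/subsetPset => x /= /lt_le_trans; apply.
    by rewrite ler_wpM2r// ler_nat.
  have UV : U = \bigcup_n V n.
    rewrite Ug eqEsubset; split => x /=.
      move=> gx; exists (Num.truncn (g x)^-1).+1 => //=.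
      by rewrite /V/= -ltr_pdivrMr// div1r truncnS_gt.
    move=> [n _ /= ngx]; rewrite lt_neqAle g0 andbT; apply/eqP => gx0.
    by move: ngx; rewrite /V/= -gx0 mulr0 ltr10.
  have /cvg_lim <- // : P' (V n) @[n --> \oo] --> P' U.
    rewrite UV; apply: nondecreasing_cvg_mu => //.
      by move=> i; exact: mo.
    by rewrite -UV; exact: mo.
  apply: lime_le.
    apply: ereal_nondecreasing_is_cvgn => n m nm; apply: le_measure.
    - by rewrite inE; exact: mo.
    - by rewrite inE; exact: mo.
    - by have /subsetPset := Vm _ _ nm.
  apply: nearW => n.
  pose h x := Num.min 1 (n%:R * g x).
  have ch : continuous h by rewrite /h; cont.
  have h0 x : 0 <= h x by rewrite /h le_min ler01 mulr_ge0.
  have indE (P0 : probability (borel T) R) (W : set (borel T)) : measurable W ->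
      P0 W = (\int[P0]_x (\1_W x)%:E)%E.
    by move=> mW; rewrite integral_indic// setIT.
  rewrite (indE _ _ (mo _ (oV n))) (indE _ _ (mo _ oU)).
  apply: (@le_trans _ _ (\int[P']_x (h x)%:E)%E).
    apply: ge0_le_integral => //.
    - by apply/measurable_EFinP; apply: measurable_indic; exact: mo.
    - exact: continuous_borelE.
    - move=> x _; rewrite lee_fin indicE.
      have [|_]/= := boolP (x \in _); last exact: h0.
      by rewrite inE /= => /ltW nx; rewrite /h le_min lexx.
  rewrite EFin_expectation// PQ'// -EFin_expectation//.
  apply: ge0_le_integral => //.
  - by move=> x _; rewrite lee_fin.
  - exact: continuous_borelE.
  - by apply/measurable_EFinP; apply: measurable_indic; exact: mo.
  - move=> x _; rewrite lee_fin indicE.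
    have [_|]/= := boolP (x \in _); first by rewrite /h ge_min lexx.
    rewrite notin_setE Ug /= => /negP; rewrite -leNgt => gx.
    rewrite /h; have -> : g x = 0 by apply/eqP; rewrite eq_le gx g0.
    by rewrite mulr0 ge_min lexx orbT.
apply: (@measure_unique _ R (borel T) (@open T) (fun=> setT)) => //.
- by move=> U V; exact: openI.
- by move=> _; exact: openT.
- by rewrite bigcup_const.
- move=> U oU; apply/eqP; rewrite eq_le !half// => f cf.
  by rewrite PQ.
- by move=> _; apply: (le_lt_trans (probability_le1 P measurableT)); exact: ltry.
Qed.

End Expectation.

(** [pushforward] in the definitions is a bare set function. The equality holds on all sets,
    measurable or not, so the probability [Q] can replace it by extensionality. *)
Lemma pushforward_probability {R : realType} {S T : ptopologicalType}
    (Sc : compact [set: S]) (P : probability (borel S) R) (h : S -> T) :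
  continuous h -> exists Q : probability (borel T) R,
    (forall A : set (borel T), Q A = P (h @^-1` A)) /\
    forall f : T -> R, continuous f -> \int[Q]_x f x = \int[P]_x f (h x).
Proof.
move=> ch; have mh := continuous_borel ch.
pose X : {mfun borel S >-> borel T} :=
  HB.pack (h : borel S -> borel T) (isMeasurableFun.Build _ _ _ _ _ mh).
exists (distribution P X); split => // f cf.
have cfh := cont_comp cf ch.
rewrite /Rintegral; congr fine.
apply: (integral_pushforward mh) => //.
- exact: continuous_borelE.
- exact: (continuous_integrable Sc P cfh).
Qed.

(** * Riesz' representation theorem *)

Section Riesz.
Context {R : realType} {T : ptopologicalType} (Tc : compact [set: T]).
Context (d : T -> T -> R) (dd : cdist d) (L : (T -> R) -> R) (SL : state L).

Let riesz_measure (A : set (borel T)) : \bar R := riesz_outer L A.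

Let borel_caratheodory (A : set (borel T)) :
  measurable A -> (riesz_outer_measure SL).-cara.-measurable A.
Proof.
move: A; apply: smallest_sub; first exact: sigma_algebra_measurable.
move=> U oU; have [g [cg g0 ->]] := open_cozero Tc dd oU.
exact: (cozero_caratheodory SL cg g0).
Qed.

Let riesz_measure0 : riesz_measure set0 = 0%E.
Proof. exact: (outer_measure0 (riesz_outer_measure SL)). Qed.

Let riesz_measure_ge0 A : (0 <= riesz_measure A)%E.
Proof. exact: (outer_measure_ge0 (riesz_outer_measure SL)). Qed.

Let riesz_measure_sigma_additive : semi_sigma_additive riesz_measure.
Proof.
move=> F mF tF mUF.
apply: (@caratheodory_measure_sigma_additive _ _ (riesz_outer_measure SL)) => //.
  by move=> i; exact: borel_caratheodory.
exact: borel_caratheodory.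
Qed.

HB.instance Definition _ := isMeasure.Build _ _ _ riesz_measure
  riesz_measure0 riesz_measure_ge0 riesz_measure_sigma_additive.

HB.instance Definition _ := Measure_isProbability.Build _ _ _ riesz_measure
  (riesz_outerT Tc SL).

(** One inequality, [\int f <= L f] for [f >= 0], suffices: applied to [f + M] and to [M - f], with
    [M] a bound of [|f|], it gives both directions. It is proved by slicing [f] into layers of
    height [h], with an error at most [h]. *)
Theorem riesz_representation : exists P : probability (borel T) R,
  forall f : T -> R, continuous f -> \int[P]_x f x = L f.
Proof.
pose P : probability (borel T) R := riesz_measure.
exists P.
have int_le (f : T -> R) : continuous f -> (forall x, 0 <= f x) -> \int[P]_x f x <= L f.
  move=> cf f0; apply/ler_addgt0Pl => h h0.
  have mpos (g : T -> R) a : continuous g ->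
      measurable ([set x : T | a < g x] : set (borel T)).
    move=> cg; rewrite [X in measurable X](_ : _ = (g : borel T -> R) @^-1` `]a, +oo[%classic).
      by rewrite -[X in measurable X]setTI; apply: continuous_borelR.
    by apply/seteqP; split => x /=; rewrite in_itv/= andbT.
  have P1 (A : set (borel T)) : measurable A -> P A \is a fin_num.
    by move=> mA; exact: fin_num_measure.
  (* Induction on the number of layers of height [h] below [g]. *)
  have step n (g : T -> R) : continuous g -> (forall x, 0 <= g x) ->
      \int[P]_x Num.min (g x) (n%:R * h) <= h * fine (P [set x : T | 0 < g x]) + L g.
    elim: n g => [|n ih] g cg g0.
      have -> : (fun x => Num.min (g x) (0%:R * h)) = fun=> 0.
        by apply/funext => x; rewrite mul0r min_r.
      rewrite (stateC (expectation_state Tc P)) addr_ge0//.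
        by rewrite mulr_ge0 ?(ltW h0)// fine_ge0.
      exact: (state_ge0 SL).
    pose g1 x := Num.min (g x) h.
    pose g2 x := Num.max (g x - h) 0.
    have cg1 : continuous g1 by rewrite /g1; cont.
    have cg2 : continuous g2 by rewrite /g2; cont.
    have g20 x : 0 <= g2 x by rewrite /g2 le_max lexx orbT.
    have g12 x : g x = g1 x + g2 x by rewrite /g1 /g2; case: (leP (g x) h) => gh;
      case: leP => gh' //; lra.
    have cm : continuous (fun x => Num.min (g2 x) (n%:R * h)) by cont.
    have -> : (fun x => Num.min (g x) (n.+1%:R * h)) =
        fun x => g1 x + Num.min (g2 x) (n%:R * h).
      apply/funext => x; rewrite /g1 /g2 -natr1 mulrDl mul1r.
      have nh : 0 <= n%:R * h by rewrite mulr_ge0// ltW.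
      set b := n%:R * h in nh *.
      case: (leP (g x) h) => gh.
        by rewrite max_r ?subr_le0// [in RHS]min_l// addr0 min_l//; lra.
      rewrite max_l ?subr_ge0 ?ltW//.
      by case: (leP (g x) (b + h)) => gb; [rewrite min_l|rewrite min_r]; lra.
    rewrite (stateD (expectation_state Tc P))//.
    (* The bounds telescope: the induction hypothesis for [g2] leaves the error [h * P {g > h}],
       which [A2] absorbs into [L g1], and [A1] creates the new error [h * P {g > 0}]. *)
    have A1 : \int[P]_x g1 x <= h * fine (P [set x : T | 0 < g x]).
      have mg := mpos g 0 cg.
      set U : set (borel T) := [set x : T | 0 < g x] in mg *.
      have iU : P.-integrable [set: borel T] (EFin \o \1_U).
        by apply: integrable_indic => //; rewrite setIT ltey_eq P1.
      have -> : h * fine (P U) = \int[P]_x (h * \1_U x).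
        by rewrite RintegralZl// /Rintegral integral_indic// setIT.
      apply: le_Rintegral => //.
      - exact: (continuous_integrable Tc).
      - exact: (integrableZl _ h iU).
      - move=> x _; rewrite indicE; have [_|] := boolP (x \in U).
          by rewrite mulr1 /g1 ge_min lexx orbT.
        by rewrite notin_setE /U/= => /negP; rewrite -leNgt mulr0 /g1 ge_min => ->.
    have A2 : h * fine (P [set x : T | h < g x]) <= L g1.
      rewrite -lee_fin EFinM fineK; last by apply: P1; exact: mpos.
      exact: (riesz_outer_layer SL cg g0 h0).
    have A3 : [set x : T | 0 < g2 x] = [set x | h < g x].
      by apply/seteqP; split => x /=; rewrite /g2 lt_max ltxx orbF subr_gt0.
    have := ih g2 cg2 g20; rewrite A3.
    have Lg : L g = L g1 + L g2.
      by rewrite -(stateD SL)//; congr L; apply/funext.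
    lra.
  (* With enough layers to reach the bound [M] the truncation is inactive, and the error is [h]
     times a probability. *)
  have [M M0 fM] := compact_bounded_fun Tc cf.
  have Mh : M <= (Num.truncn (M / h)).+1%:R * h.
    by rewrite -ler_pdivrMr//; apply/ltW/truncnS_gt.
  have := step (Num.truncn (M / h)).+1 f cf f0.
  have -> : (fun x => Num.min (f x) ((Num.truncn (M / h)).+1%:R * h)) = f.
    apply/funext => x; apply/min_idPl/(le_trans _ Mh).
    by apply: le_trans (fM x); exact: ler_norm.
  move/le_trans; apply; rewrite lerD2r ger_pMr// -lee_fin fineK.
    by apply: probability_le1; exact: mpos.
  by apply: P1; exact: mpos.
move=> f cf; have [M M0 fM] := compact_bounded_fun Tc cf.
have EP := expectation_state Tc P.
have cM := contC M : continuous (fun _ : T => M).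
apply/eqP; rewrite eq_le; apply/andP; split.
  have := int_le (fun x => f x + M) (contD cf cM).
  rewrite (stateD EP)// (stateD SL)// (stateC EP) (stateC SL) lerD2r; apply=> x.
  by have := fM x; rewrite ler_norml => /andP[+ _]; lra.
have := int_le (fun x => M - f x) (contB cM cf).
rewrite (stateB EP)// (stateB SL)// (stateC EP) (stateC SL) lerD2l lerN2; apply=> x.
by rewrite subr_ge0; apply: le_trans (fM x); exact: ler_norm.
Qed.

End Riesz.

(** * Partitions of unity and limits along ultrafilters *)

Section PartitionOfUnity.
Context {R : realType} {T : ptopologicalType} (Tc : compact [set: T]).
Context (d : T -> T -> R) (dd : cdist d).

Lemma cdist_nbhs (A : set T) x : nbhs x A ->
  exists2 e : R, 0 < e & forall y, d x y < e -> A y.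
Proof.
move=> /nbhs_interior; rewrite nbhsE => -[U [oU Ux] UA].
have [e e0 H] := cdist_open Tc dd oU Ux.
by exists e => // y /H /UA /nbhs_singleton.
Qed.

(** The tents [max (e - d a x) 0], centred at the points of a finite cover by balls of radius [e],
    are divided by their sum, which is positive because the balls cover. *)
Lemma partition_of_unity (e : R) : 0 < e ->
  exists (s : seq T) (phi : T -> T -> R),
    [/\ forall a, continuous (phi a), forall a x, 0 <= phi a x,
        forall x, \sum_(a <- s) phi a x = 1
      & forall a x, phi a x != 0 -> d a x < e].
Proof.
move=> e0; have [dxx _ _ dc _] := dd.
have := Tc; rewrite compact_cover => /(_ T setT (fun a => [set x | d a x < e])) [].
- move=> a _; rewrite [X in open X](_ : _ = d a @^-1` `]-oo, e[%classic).
    by apply: open_comp; [move=> x _; exact: dc|exact: lray_open].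
  by apply/seteqP; split => x /=; rewrite in_itv.
- by move=> x _; exists x => //=; rewrite dxx.
move=> D _ cov; pose s : seq T := finmap.enum_fset D.
pose psi a x := Num.max (e - d a x) 0.
have psi0 a x : 0 <= psi a x by rewrite /psi le_max lexx orbT.
have cpsi a : continuous (psi a) by rewrite /psi; have := dc a => ?; cont.
pose S x := \sum_(a <- s) psi a x.
have S0 x : 0 < S x.
  have [a /= aD ax] := cov x I.
  rewrite /S (big_rem a)//=; apply: ltr_wpDr; first by apply: sumr_ge0.
  by rewrite /psi lt_max subr_gt0 ax.
have cS : continuous S by apply: cont_sum.
exists s, (fun a x => psi a x * (S x)^-1); split.
- move=> a; apply: contM => // x.
  by apply: cvgV; [rewrite gt_eqF ?S0|exact: cS].
- by move=> a x; rewrite mulr_ge0// invr_ge0 ltW.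
- by move=> x; rewrite -mulr_suml divff ?gt_eqF ?S0.
- move=> a x; rewrite mulf_eq0 negb_or => /andP[+ _].
  by rewrite /psi; case: (leP (e - d a x) 0) => [_|+ _]; rewrite ?eqxx ?subr_gt0.
Qed.

End PartitionOfUnity.

(** * Uniform continuity and continuity in a parameter *)

Section UniformContinuity.
Context {R : realType}.

Lemma continuous_pair_near (X Y : ptopologicalType) (f : X * Y -> R) x y e :
  continuous f -> 0 < e ->
  \forall x' \near x & y' \near y, `|f (x, y) - f (x', y')| < e.
Proof.
move=> cf e0; have /cvgrPdist_lt/(_ _ e0) := cf (x, y).
by apply: filterS => -[].
Qed.

Lemma uniform_in_fst (X Y : ptopologicalType) (d : X -> X -> R)
    (f : X * Y -> R) (e : R) :
  compact [set: X] -> compact [set: Y] -> cdist d -> continuous f -> 0 < e ->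
  exists2 r : R, 0 < r & forall x x' y, d x x' < r -> `|f (x, y) - f (x', y)| < e.
Proof.
move=> Xc Yc dd cf e0; have [dxx ds dt dc _] := dd.
have cXY : compact [set: X * Y] by rewrite -setXTT; exact: compact_setX.
have e20 : 0 < e / 2 by rewrite divr_gt0.
have : \forall r \near (0:R)^'+, [set: X * Y] `<=`
    [set z | forall x', d z.1 x' < r -> `|f (z.1, z.2) - f (x', z.2)| < e].
  apply: (compact_near_coveringP _).1 cXY _ _
    (fun r z => forall x', d z.1 x' < r -> `|f (z.1, z.2) - f (x', z.2)| < e) _ _.
  move=> [x y] _ /=.
  have [[U V] /= [Ux Vy] UV] := continuous_pair_near x y cf e20.
  have [r r0 rU] := cdist_nbhs Xc dd Ux.
  have r20 : 0 < r / 2 by rewrite divr_gt0.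
  (* Halving leaves room for two moves: from [x] to [x'], then from [x'] to [x''], without leaving
     the ball of radius [r]. *)
  exists ([set z | d x z.1 < r / 2 /\ V z.2], [set r' | r' < r / 2]) => /=.
    split; last exact: nbhs_right_lt.
    exists ([set x' | d x x' < r / 2], V) => /=; last by move=> [].
    split => //; have nb : \forall t \near nbhs (d x x), t < r / 2.
      by apply: lt_nbhsl; rewrite dxx.
    exact: (dc x x) _ nb.
  move=> [[x' y'] r'] /= [[xx' Vy'] r'r] x'' x'x''.
  have xr : d x x' < r by apply: (lt_le_trans xx'); lra.
  have xr2 : d x x'' < r by apply: (le_lt_trans (dt x x' x'')); lra.
  have A1 := UV (x', y') (conj (rU _ xr) Vy').
  have A2 := UV (x'', y') (conj (rU _ xr2) Vy').
  rewrite (splitr e) (le_lt_trans (ler_distD (f (x, y)) _ _))//.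
  by rewrite ltrD// distrC.
move=> H; have [r [Hr r0]] := filter_ex (filterI H (nbhs_right_gt 0)).
by exists r => // x x' y; exact: (Hr (x, y) I).
Qed.

Lemma uniform_cdist (X : ptopologicalType) (d : X -> X -> R) (f : X -> R) (e : R) :
  compact [set: X] -> cdist d -> continuous f -> 0 < e ->
  exists2 r : R, 0 < r & forall x x', d x x' < r -> `|f x - f x'| < e.
Proof.
move=> Xc dd cf e0.
have cf1 : continuous (fun z : X * X => f z.1).
  by apply: cont_comp => //; move=> z; exact: cvg_fst.
have [r r0 H] := uniform_in_fst Xc Xc dd cf1 e0.
by exists r => // x x' /H - /(_ x).
Qed.

(** Compactness of [Y] makes the sections of [f] vary uniformly, and a state is 1-Lipschitz for the
    supremum norm. *)
Lemma state_section (X Y : ptopologicalType) (L : (Y -> R) -> R) (f : X * Y -> R) :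
  compact [set: Y] -> state L -> continuous f ->
  continuous (fun x => L (fun y => f (x, y))).
Proof.
move=> Yc SL cf x; apply/cvgrPdist_le => e e0.
have cs x' : continuous (fun y => f (x', y)).
  by apply: cont_comp => // y; apply: cvg_pair; [exact: cvg_cst|exact: cvg_id].
have e20 : 0 < e / 2 by rewrite divr_gt0.
have : \forall x' \near x, [set: Y] `<=` [set y | `|f (x, y) - f (x', y)| < e].
  apply: (compact_near_coveringP _).1 Yc _ _
    (fun x' y => `|f (x, y) - f (x', y)| < e) _ _.
  move=> y _; have [[A B] /= [Ax By] AB] := continuous_pair_near x y cf e20.
  exists (B, A) => //= -[y' x'] /= [By' Ax'].
  rewrite (splitr e) (le_lt_trans (ler_distD (f (x, y)) _ _))// ltrD//.
    by rewrite distrC; apply: (AB (x, y')); split => //; exact: nbhs_singleton.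
  exact: (AB (x', y')).
apply: filterS => x' H.
by apply: (state_dist SL) => // y; apply/ltW/H.
Qed.

End UniformContinuity.

Section UltraLimit.
Context {R : realType} (U : set_system nat) (UU : UltraFilter U).

(** A cluster point exists in the compact segment, and a cluster point of an ultrafilter is a
    limit. *)
Lemma ultra_bounded_cvg (v : nat -> R) M : (forall n, `|v n| <= M) ->
  cvg (v n @[n --> U]).
Proof.
move=> vM; have PU : ProperFilter U := ultra_proper.
have [p [_ pc]] : `[- M, M]%classic `&` cluster (v n @[n --> U]) !=set0.
  apply: (segment_compact (a := - M) (b := M)).
  by apply: nearW => n /=; rewrite in_itv/= -ler_norml.
apply/cvg_ex; exists p => V Vp.
have [//|H] := in_ultra_setVsetC (v @^-1` V) UU.
have [y [/= nVy Vy]] : ~` V `&` V !=set0 by apply: pc => //.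
by [].
Qed.

Context {T : ptopologicalType} (Tc : compact [set: T]).
Context (L : nat -> (T -> R) -> R) (SL : forall n, state (L n)).

(** [lim] returns a default value when there is no limit; on continuous functions, which are
    bounded, the limit exists. *)
Definition ultralim (f : T -> R) : R := lim (L n f @[n --> U]).

Lemma ultralim_cvg f : continuous f -> L n f @[n --> U] --> ultralim f.
Proof.
move=> cf; have [M _ fM] := compact_bounded_fun Tc cf.
apply: (@ultra_bounded_cvg _ M) => n.
exact: (state_norm (SL n) cf fM).
Qed.

Lemma ultralimE f l : L n f @[n --> U] --> l -> ultralim f = l.
Proof.
by move=> fl; apply/cvg_lim.
Qed.

Lemma ultralim_state : state ultralim.
Proof.
have PU : ProperFilter U := ultra_proper.
split.
- apply: ultralimE; under eq_fun do rewrite state1//; exact: cvg_cst.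
- move=> f g cf cg; apply: ultralimE.
  under eq_fun do rewrite stateD//.
  by apply: cvgD; exact: ultralim_cvg.
- move=> a f cf; apply: ultralimE.
  under eq_fun do rewrite stateZ//.
  by apply: cvgMr; exact: ultralim_cvg.
- move=> f cf f0; apply: limr_ge; first exact: (cvgP _ (ultralim_cvg cf)).
  by apply: nearW => n; exact: (state_ge0 (SL n)).
Qed.

End UltraLimit.

Lemma near_all_seq (I : Type) (J : choiceType) (F : set_system I) (s : seq J)
    (P : J -> I -> Prop) : Filter F ->
  (forall a, \forall n \near F, P a n) ->
  \forall n \near F, forall a, a \in s -> P a n.
Proof.
move=> FF FP; elim: s => [|b s ih]; first exact: nearW.
have := FP b; apply: filterS2 ih => n H Pb a.
by rewrite inE => /predU1P[->//|]; exact: H.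
Qed.

Lemma cvg_sum_seq (R : realType) (I : Type) (J : choiceType) (F : set_system I)
    (s : seq J) (u : J -> I -> R) (l : J -> R) : Filter F ->
  (forall a, a \in s -> u a n @[n --> F] --> l a) ->
  \sum_(a <- s) u a n @[n --> F] --> \sum_(a <- s) l a.
Proof.
move=> FF; elim: s => [|b s ih] H.
  by under eq_fun do rewrite big_nil; rewrite big_nil; exact: cvg_cst.
under eq_fun do rewrite big_cons; rewrite big_cons; apply: cvgD.
  by apply: H; rewrite mem_head.
by apply: ih => a sa; apply: H; rewrite inE sa orbT.
Qed.

(** * Weak sequential compactness of probabilities *)

Section SequentialCompactness.
Context {R : realType} {T : ptopologicalType} (Tc : compact [set: T]).
Context (d : T -> T -> R) (dd : cdist d).

(** The difference is the average of [f x - f a] with weights [phi a x], which vanish unless [a] is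
    near [x]. *)
Lemma partition_approx (s : seq T) (phi : T -> T -> R) (f : T -> R) e r :
  (forall a x, 0 <= phi a x) -> (forall x, \sum_(a <- s) phi a x = 1) ->
  (forall a x, phi a x != 0 -> d a x < r) ->
  (forall x y, d x y < r -> `|f x - f y| < e) ->
  forall x, `|f x - \sum_(a <- s) f a * phi a x| <= e.
Proof.
move=> phi0 phi1 phir fr x.
rewrite -[f x]mulr1 -(phi1 x) mulr_sumr -sumrB (le_trans (ler_norm_sum _ _ _))//.
rewrite -[leRHS]mulr1 -(phi1 x) mulr_sumr; apply: ler_sum => a _.
rewrite -mulrBl normrM (ger0_norm (phi0 _ _)).
have [->|/phir/fr] := eqVneq (phi a x) 0; first by rewrite !mulr0.
by rewrite distrC => /ltW; apply: ler_wpM2r.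
Qed.

(** The ultrafilter supplies the limit [l] but no subsequence. Countably many test functions suffice
    to extract one: the bumps of partitions of unity of mesh [1/(k+1)], whose combinations
    approximate every continuous function uniformly. *)
Theorem probability_sequentially_compact (m : nat -> probability (borel T) R) :
  exists phi : nat -> nat, {homo phi : m n / (m < n)%N} /\
    exists l : probability (borel T) R, weak_cvg (fun n => m (phi n)) l.
Proof.
have [U [UU ooU]] := ultraFilterLemma (@eventually_filter).
have PU : ProperFilter U := ultra_proper.
have SE n := expectation_state Tc (m n).
have [l El] := riesz_representation Tc dd (ultralim_state UU Tc SE).
have [El' SL] : (forall f, continuous f -> \int[m n]_x f x @[n --> U] --> \int[l]_x f x)
    /\ state (fun f => \int[l]_x f x).
  split; last exact: expectation_state.
  by move=> f cf; rewrite El//; exact: (ultralim_cvg UU Tc SE).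
have /choice[s /choice[phi Hphi]] (k : nat) : exists s : seq T, exists phi : T -> T -> R,
    [/\ forall a, continuous (phi a), forall a x, 0 <= phi a x,
        forall x, \sum_(a <- s) phi a x = 1
      & forall a x, phi a x != 0 -> d a x < k.+1%:R^-1].
  exact: (partition_of_unity Tc dd).
(* Finitely many conditions for each [N], hence true on a set of [U]; as [U] also contains all
   tails, a good index can be found beyond any given one. *)
pose good N n := forall k, k \in iota 0 N -> forall a, a \in s k ->
  `|\int[l]_x phi k a x - \int[m n]_x phi k a x| < N.+1%:R^-1.
have goodU N : \forall n \near U, good N n.
  apply: near_all_seq => k; apply: near_all_seq => a.
  have [ck _ _ _] := Hphi k.
  have /cvgrPdist_lt := El' _ (ck a); apply.
  by rewrite invr_gt0.
have /choice[nxt Hnxt] (Nk : nat * nat) : exists n, (Nk.2 < n)%N /\ good Nk.1 n.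
  apply: (@filter_ex _ U); apply: filterI; last exact: goodU.
  by apply: ooU; exact: nbhs_infty_gt.
pose fix psi n := if n is n'.+1 then nxt (n, psi n') else nxt (0%N, 0%N).
exists psi; split.
  apply: homo_ltn; first exact: ltn_trans.
  by move=> i; have [] := Hnxt (i.+1, psi i).
exists l => f cf _.
have goodpsi n : good n (psi n) by case: n => [|n]; [have [] := Hnxt (0%N,0%N)|have [] := Hnxt (n.+1, psi n)].
rewrite EFin_expectation//.
under eq_fun do rewrite EFin_expectation//.
apply: cvg_EFin; first exact: nearW.
apply/cvgrPdist_le => e e0.
have e30 : 0 < e / 3%:R by rewrite divr_gt0.
have [r r0 fr] := uniform_cdist Tc dd cf e30.
pose k := Num.truncn r^-1.
have kr : k.+1%:R^-1 <= r.
  by rewrite -[leRHS]invrK lef_pV2 ?posrE ?invr_gt0//; exact/ltW/truncnS_gt.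
have [ck k0 k1 kd] := Hphi k.
pose F x := \sum_(a <- s k) f a * phi k a x.
have cF a : continuous (fun x => f a * phi k a x) by have := ck a => ?; cont.
have fF x : `|f x - F x| <= e / 3%:R.
  apply: (partition_approx k0 k1 kd) => x' y xy; apply: fr.
  exact: lt_le_trans kr.
have cvF : \int[m (psi n)]_x F x @[n --> \oo] --> \int[l]_x F x.
  rewrite (state_sum SL)//.
  under eq_fun do rewrite (state_sum (SE _))//.
  apply: cvg_sum_seq => a sa; rewrite (stateZ SL)//.
  under eq_fun do rewrite (stateZ (SE _))//.
  apply: cvgMr; apply/cvgrPdist_lt => e1 e10.
  near=> n.
  have kn : k \in iota 0 n by rewrite mem_iota/= add0n; near: n; exact: nbhs_infty_gt.
  apply: (lt_le_trans (goodpsi n k kn a sa)).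
  rewrite -[leRHS]invrK lef_pV2 ?posrE ?invr_gt0//.
  apply: (le_trans (ltW (truncnS_gt _))); rewrite ler_nat ltnS.
  by near: n; exact: nbhs_infty_ge.
have cFF : continuous F by exact: cont_sum.
have /cvgrPdist_le/(_ _ e30) := cvF.
apply: filterS => n Hn.
have A1 := state_dist SL cf cFF fF.
have A2 := state_dist (SE (psi n)) cf cFF fF.
rewrite (_ : e = e / 3%:R + e / 3%:R + e / 3%:R); last by lra.
move: A1 A2 Hn => /=; rewrite !ler_norml => /andP[? ?] /andP[? ?] /andP[? ?].
by apply/andP; split; lra.
Unshelve. all: by end_near. Qed.

End SequentialCompactness.

(** * Perturbation of couplings *)

Section DistanceInstances.
Context {R : realType}.

Lemma cdist_continuous (T : ptopologicalType) (d : T -> T -> R) :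
  (forall x y, d x y = d y x) -> (forall x y z, d x z <= d x y + d y z) ->
  (forall x e, 0 < e -> \forall y \near x, d x y < e) ->
  forall a, continuous (d a).
Proof.
move=> ds dt dn a x; apply/cvgrPdist_lt => e e0.
apply: filterS (dn x e e0) => y xy; apply: le_lt_trans xy.
have := dt a x y; have := dt a y x; rewrite (ds y x) ler_norml => ? ?.
by apply/andP; split; lra.
Qed.

(** [edist] may be infinite; truncating it at 1 keeps the triangle inequality and yields a real
    number. *)
Definition pdist (X : pseudoPMetricType R) (x y : X) : R :=
  fine (mine (edist (x, y)) 1%E).

Lemma pdist_cdist (X : pseudoPMetricType R) :
  hausdorff_space X -> cdist (@pdist X).
Proof.
move=> Xh.
have fin (x y : X) : mine (edist (x, y)) 1%E \is a fin_num.
  rewrite ge0_fin_numE; first by rewrite gt_min; apply/orP; right; exact: ltry.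
  by rewrite le_min edist_ge0 lee01.
have dE (x y : X) : (pdist x y)%:E = mine (edist (x, y)) 1%E by exact: (fineK (fin x y)).
have ds (x y : X) : pdist x y = pdist y x by rewrite /pdist edist_sym.
have dt (x y z : X) : pdist x z <= pdist x y + pdist y z.
  rewrite -lee_fin EFinD !dE.
  have e0 := @edist_ge0 R X; have e1 := edist_triangle x y z.
  have [yx|yx] := leP (edist (x, y)) 1%E; have [yz|yz] := leP (edist (y, z)) 1%E.
  - by rewrite ge_min e1.
  - by rewrite ge_min (leeDr 1%E (e0 _)) orbT.
  - by rewrite ge_min (leeDl 1%E (e0 _)) orbT.
  - by rewrite ge_min (@leeDl _ 1%E 1%E)// orbT.
have dn (x : X) e : 0 < e -> \forall y \near x, pdist x y < e.
  move=> e0; have e20 : 0 < e / 2 by rewrite divr_gt0.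
  have := nbhsx_ballx x _ e20; apply: filterS => y xy.
  rewrite -lte_fin dE gt_min (@le_lt_trans _ _ (e / 2)%:E)//.
    exact: edist_fin.
  by rewrite lte_fin; lra.
split => //.
- by move=> x; rewrite /pdist edist_refl min_l.
- exact: cdist_continuous.
- move=> x y xy; have := dE x y; rewrite xy => /esym; rewrite /mine.
  case: ifPn => [_ xy0|_ [/eqP]]; last by rewrite oner_eq0.
  by apply: (close_eq Xh); apply/edist_closeP.
Qed.

Lemma prod_cdist (X Y : ptopologicalType) (dX : X -> X -> R) (dY : Y -> Y -> R) :
  cdist dX -> cdist dY -> cdist (fun z z' : X * Y => dX z.1 z'.1 + dY z.2 z'.2).
Proof.
move=> ddX ddY; have [X0 Xs Xt Xc X1] := ddX; have [Y0 Ys Yt Yc Y1] := ddY.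
split.
- by move=> z; rewrite X0 Y0 addr0.
- by move=> z z'; rewrite Xs Ys.
- by move=> x y z; have := Xt x.1 y.1 z.1; have := Yt x.2 y.2 z.2; lra.
- move=> z; apply: contD; apply: cont_comp => //.
    by move=> x; exact: cvg_fst.
  by move=> x; exact: cvg_snd.
- move=> [x y] [x' y'] /= H.
  have := cdist_ge0 ddX x x'; have := cdist_ge0 ddY y y' => ? ?.
  by congr pair; [apply: X1|apply: Y1]; lra.
Qed.

Lemma prod_topology_cdist (K : nat) (Y : 'I_K -> ptopologicalType)
    (d : forall k, Y k -> Y k -> R) : (forall k, cdist (d k)) ->
  cdist (fun y y' : prod_topology Y => \sum_k d k (y k) (y' k)).
Proof.
move=> dd; split.
- by move=> y; rewrite big1// => k _; have [] := dd k.
- by move=> y y'; apply: eq_bigr => k _; have [] := dd k.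
- move=> x y z; rewrite -big_split; apply: ler_sum => k _ /=.
  by have [_ _ dt _ _] := dd k; exact: dt.
- move=> y; apply: cont_sum => k; apply: cont_comp; first by have [_ _ _ dc _] := dd k; exact: dc.
  exact: proj_continuous.
- move=> x y /eqP; rewrite psumr_eq0; last first.
    by move=> k _; exact: cdist_ge0.
  move=> /allP H; apply/functional_extensionality_dep => k.
  have [_ _ _ _ d0] := dd k; apply: d0; apply/eqP.
  by have := H k (mem_index_enum k).
Qed.

Lemma compact_prod_topology (K : nat) (Y : 'I_K -> ptopologicalType) :
  (forall k, compact [set: Y k]) -> compact [set: prod_topology Y].
Proof.
move=> H; have := @tychonoff _ Y (fun k => setT) H.
by congr compact; apply/seteqP; split.
Qed.

Lemma compact_prod (X Y : ptopologicalType) :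
  compact [set: X] -> compact [set: Y] -> compact [set: X * Y].
Proof. by move=> Xc Yc; rewrite -setXTT; exact: compact_setX. Qed.

End DistanceInstances.

Section PerturbedCoupling.
Context {R : realType} {X Y : ptopologicalType}.
Context (Xc : compact [set: X]) (Yc : compact [set: Y]).

Definition coupled (p : (X * Y -> R) -> R) (l : (X -> R) -> R) (n : (Y -> R) -> R) :=
  (forall f, continuous f -> p (fun z => f z.1) = l f) /\
  (forall g, continuous g -> p (fun z => g z.2) = n g).

Context (l m : (X -> R) -> R) (n : (Y -> R) -> R) (p : (X * Y -> R) -> R).
Context (Sm : state m) (Sn : state n) (Sp : state p).
Context (pln : coupled p l n).
Context (s : seq X) (phi : X -> X -> R) (r : R).
Context (phic : forall a, continuous (phi a)) (phi0 : forall a x, 0 <= phi a x).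
Context (phi1 : forall x, \sum_(a <- s) phi a x = 1).
Context (r0 : 0 <= r) (r1 : r <= 1).
Context (rlm : forall a, a \in s -> r * l (phi a) <= m (phi a)).

Let cXY := compact_prod Xc Yc.

(** [w a] has [m]-mass [r] when [m (phi a)] is nonzero, so integrating the kernel against [m]
    recovers [r * p] from the bumps. If [m (phi a) = 0], division by zero makes [w a] vanish,
    consistently with [rlm], which forces [r * l (phi a) = 0]. *)
Let w a x := r / m (phi a) * phi a x.
Let v x := 1 - \sum_(a <- s) w a x * l (phi a).

Let kernel x (g : Y -> R) : R :=
  \sum_(a <- s) w a x * p (fun z => phi a z.1 * g z.2) + v x * n g.

(* [m] composed with a Markov kernel: near the point [a], [x] is sent to the law
   of the second coordinate under [p] conditioned by [phi a], with a defect [v]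
   of total mass [1 - r] that is sent to [n]. *)
Definition perturbed_coupling (f : X * Y -> R) : R :=
  m (fun x => kernel x (fun y => f (x, y))).

Local Notation q := perturbed_coupling.

Let wc a : continuous (w a).
Proof. by have := @phic a => ?; rewrite /w; cont. Qed.

Let vc : continuous v.
Proof.
apply: contB; first exact: contC.
by apply: cont_sum => a; apply: contM => //; exact: contC.
Qed.

Let w0 a x : a \in s -> 0 <= w a x.
Proof.
by move=> sa; rewrite /w mulr_ge0// divr_ge0//; exact: (state_ge0 Sm).
Qed.

(** With 1 written as the sum of the [phi a x], the inequality holds term by term: [rlm] says that
    [r * l (phi a) / m (phi a)] is at most 1. *)
Let v0 x : 0 <= v x.
Proof.
rewrite /v subr_ge0 -(phi1 x) big_seq [leRHS]big_seq; apply: ler_sum => a sa.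
rewrite /w mulrAC ler_piMl//.
have [->|m0] := eqVneq (m (phi a)) 0; first by rewrite invr0 mulr0 mul0r.
rewrite mulrAC ler_pdivrMr ?mul1r ?rlm//.
by rewrite lt_neqAle eq_sym m0; exact: (state_ge0 Sm).
Qed.

Let fstc : continuous (@fst X Y). Proof. by move=> z; exact: cvg_fst. Qed.
Let sndc : continuous (@snd X Y). Proof. by move=> z; exact: cvg_snd. Qed.

Let phifst a : continuous (fun z : X * Y => phi a z.1).
Proof. exact: cont_comp (@phic a) fstc. Qed.

Let section_cont (f : X * Y -> R) x : continuous f -> continuous (fun y => f (x, y)).
Proof.
by move=> cf; apply: cont_comp => // y; apply: cvg_pair; [exact: cvg_cst|exact: cvg_id].
Qed.

Let phig a (g : Y -> R) : continuous g -> continuous (fun z : X * Y => phi a z.1 * g z.2).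
Proof. by move=> cg; apply: contM => //; exact: cont_comp cg sndc. Qed.

Let phif (f : X * Y -> R) x a : continuous f ->
  continuous (fun z : X * Y => phi a z.1 * f (x, z.2)).
Proof. by move=> cf; exact: (phig (@section_cont f x cf)). Qed.

Let pc (f : X * Y -> R) a : continuous f ->
  continuous (fun x => p (fun z => phi a z.1 * f (x, z.2))).
Proof.
move=> cf.
have := @state_section _ X (X * Y)%type p
  (fun u : X * (X * Y) => phi a u.2.1 * f (u.1, u.2.2)) cXY Sp; apply.
have c1 : continuous (fun u : X * (X * Y) => u.1) by move=> u; exact: cvg_fst.
have c2 : continuous (fun u : X * (X * Y) => u.2) by move=> u; exact: cvg_snd.
apply: contM; first exact: (cont_comp (@phifst a) c2).
apply: cont_comp => // u; apply: cvg_pair; first exact: c1.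
exact: (cont_comp sndc c2).
Qed.

Let nc (f : X * Y -> R) : continuous f -> continuous (fun x => n (fun y => f (x, y))).
Proof. by move=> cf; exact: (state_section Yc Sn cf). Qed.

Let kc1 (f : X * Y -> R) a : continuous f ->
  continuous (fun x => w a x * p (fun z => phi a z.1 * f (x, z.2))).
Proof. by move=> cf; apply: contM; [exact: wc|exact: pc]. Qed.

Let kc2 (f : X * Y -> R) : continuous f ->
  continuous (fun x => v x * n (fun y => f (x, y))).
Proof. by move=> cf; apply: contM; [exact: vc|exact: nc]. Qed.

Let kc (f : X * Y -> R) : continuous f ->
  continuous (fun x => kernel x (fun y => f (x, y))).
Proof.
move=> cf; apply: contD; last exact: kc2.
by apply: cont_sum => a; exact: kc1.
Qed.

Let pl a : p (fun z => phi a z.1) = l (phi a).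
Proof. by have [H _] := pln; exact: H. Qed.

Let kernelC x t : kernel x (fun=> t) = t.
Proof.
rewrite /kernel (stateC Sn) [X in X + _](_ : _ = (\sum_(a <- s) w a x * l (phi a)) * t).
  by rewrite /v; lra.
rewrite mulr_suml; apply: eq_bigr => a _.
rewrite -pl -mulrA [X in _ = _ * X]mulrC -(stateZ Sp t (@phifst a)).
by congr (_ * p _); apply/funext => z; rewrite mulrC.
Qed.

Lemma perturbed_coupling_state : state q.
Proof.
split.
- by rewrite /q; under eq_fun do rewrite kernelC; exact: state1.
- move=> f g cf cg; rewrite /q -(stateD Sm (kc cf) (kc cg)); congr m; apply/funext => x.
  rewrite /kernel (stateD Sn); [|exact: section_cont|exact: section_cont].
  rewrite mulrDr addrACA -big_split; congr (_ + _); apply: eq_bigr => a _ /=.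
  rewrite -mulrDr -(stateD Sp); [|exact: phif|exact: phif].
  by congr (_ * p _); apply/funext => z; rewrite mulrDr.
- move=> t f cf; rewrite /q -(stateZ Sm t (kc cf)); congr m; apply/funext => x.
  rewrite /kernel (stateZ Sn); last exact: section_cont.
  rewrite mulrDr mulr_sumr mulrCA; congr (_ + _); apply: eq_bigr => a _.
  rewrite mulrCA -(stateZ Sp t (phif cf)).
  by congr (_ * p _); apply/funext => z; rewrite mulrCA.
- move=> f cf f0; apply: (state_ge0 Sm); first exact: kc.
  move=> x; apply: addr_ge0.
    rewrite big_seq; apply: sumr_ge0 => a sa; apply: mulr_ge0; first by apply: w0.
    apply: (state_ge0 Sp); first exact: phif.
    by move=> z; rewrite mulr_ge0.
  apply: mulr_ge0 => //; apply: (state_ge0 Sn); first exact: section_cont.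
  by [].
Qed.

(* If [m (phi a) = 0] then [r * l (phi a) = 0], so [r * p (phi a * F)] vanishes too. *)
Let cancel a (F : X * Y -> R) : a \in s -> continuous F ->
  r / m (phi a) * m (phi a) * p (fun z => phi a z.1 * F z) =
  r * p (fun z => phi a z.1 * F z).
Proof.
move=> sa cF; have [m0|m0] := eqVneq (m (phi a)) 0; last by rewrite divfK.
rewrite m0 mulr0 mul0r; apply/esym/eqP; rewrite -normr_eq0 normrM (ger0_norm r0).
have [M M0 FM] := compact_bounded_fun cXY cF.
have cpF : continuous (fun z => phi a z.1 * F z) by exact: contM.
have cMp : continuous (fun z : X * Y => M * phi a z.1) by apply: contM => //; exact: contC.
have H : `|p (fun z => phi a z.1 * F z)| <= M * l (phi a).
  rewrite -pl -(stateZ Sp)// ler_norml -(stateN Sp)//.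
  have cNp := contN cMp.
  apply/andP; split; apply: (state_le Sp) => // z.
    rewrite -mulNr mulrC ler_wpM2l// lerNl.
    by apply: le_trans (FM z); rewrite -normrN ler_norm.
  by rewrite mulrC ler_wpM2r//; apply: le_trans (FM z); exact: ler_norm.
rewrite eq_le mulr_ge0// andbT.
apply: (le_trans (ler_wpM2l r0 H)); rewrite mulrCA -(mulr0 M) ler_wpM2l// -m0.
exact: rlm.
Qed.

Let sum_phi (F : X * Y -> R) : continuous F ->
  \sum_(a <- s) p (fun z => phi a z.1 * F z) = p F.
Proof.
move=> cF; rewrite -(state_sum Sp); last by move=> a; exact: contM.
by congr p; apply/funext => z; rewrite -mulr_suml phi1 mul1r.
Qed.

Let mw a : m (w a) = r / m (phi a) * m (phi a).
Proof. by rewrite -(stateZ Sm). Qed.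

Let mv : m v = 1 - r.
Proof.
have cw a : continuous (fun x => w a x * l (phi a)) by apply: contM => //; exact: contC.
rewrite (stateB Sm); [|exact: contC|exact: cont_sum].
rewrite (stateC Sm) (state_sum Sm)//; congr (_ - _).
have one : continuous (fun _ : X * Y => 1 : R) := contC 1.
rewrite -[RHS]mulr1 -(stateC Sp 1) -(sum_phi one) mulr_sumr.
rewrite big_seq [RHS]big_seq; apply: eq_bigr => a sa.
rewrite -cancel//; under [in RHS]eq_fun do rewrite mulr1.
rewrite pl -mw mulrC -(stateZ Sm)//; congr m; apply/funext => x.
by rewrite mulrC.
Qed.

Lemma perturbed_coupling_coupled : coupled q m n.
Proof.
split=> [f cf|g cg].
  by congr m; apply/funext => x; exact: (@kernelC x (f x)).
have cwp a : continuous (fun x => p (fun z => phi a z.1 * g z.2) * w a x).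
  by apply: contM => //; exact: contC.
have cgs : continuous (fun z : X * Y => g z.2) by exact: cont_comp cg sndc.
rewrite /q; have -> : (fun x => kernel x (fun y => g y)) = fun x =>
    \sum_(a <- s) p (fun z => phi a z.1 * g z.2) * w a x + n g * v x.
  apply/funext => x; rewrite /kernel mulrC; congr (_ + _).
  by apply: eq_bigr => a _; rewrite mulrC.
have cng : continuous (fun x => n g * v x) by apply: contM => //; exact: contC.
rewrite (stateD Sm)//; last exact: cont_sum.
rewrite (state_sum Sm)// (stateZ Sm)// mv.
have -> : \sum_(a <- s) m (fun x => p (fun z => phi a z.1 * g z.2) * w a x) = r * n g.
  have [_ pn] := pln; rewrite -pn// -(sum_phi cgs) mulr_sumr.
  rewrite big_seq [RHS]big_seq; apply: eq_bigr => a sa.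
  by rewrite (stateZ Sm)// mw mulrC cancel.
by lra.
Qed.

(** Within one bump, replacing the first coordinate of [p] by [x] costs at most [e]; the defect [v],
    of mass [1 - r], costs at most [M] per unit of mass. *)
Lemma perturbed_coupling_cost (c : X * Y -> R) (e M : R) : continuous c ->
  (forall z, 0 <= c z) -> (forall z, c z <= M) -> 0 <= e ->
  (forall a x x' y, phi a x != 0 -> phi a x' != 0 -> `|c (x, y) - c (x', y)| <= e) ->
  q c <= p c + e + (1 - r) * M.
Proof.
move=> cc c0 cM e0 ce.
have ce1 : continuous (fun z => c z + e) by apply: contD => //; exact: contC.
have k1 a := @kc1 _ a cc; have k2 := kc2 cc.
rewrite /q (stateD Sm)//; last by apply: cont_sum => a; exact: k1.
rewrite (state_sum Sm)//; apply: lerD.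
  apply: (@le_trans _ _ (\sum_(a <- s) r * p (fun z => phi a z.1 * (c z + e)))).
    rewrite big_seq [leRHS]big_seq; apply: ler_sum => a sa.
    rewrite -cancel// -mw mulrC -(stateZ Sm)//; apply: (state_le Sm) => // [|x].
      by apply: contM => //; exact: contC.
    rewrite mulrC; have [px0|px] := eqVneq (phi a x) 0.
      by rewrite /w px0 mulr0 !mulr0.
    rewrite ler_wpM2r ?w0//; apply: (state_le Sp).
    - exact: phif.
    - by apply: contM.
    - move=> z; have [->|pz] := eqVneq (phi a z.1) 0; first by rewrite !mul0r.
      rewrite ler_wpM2l//; have := ce a x z.1 z.2 px pz.
      by rewrite -surjective_pairing ler_norml => /andP[_]; lra.
  rewrite -mulr_sumr sum_phi// (stateD Sp)//; last exact: contC.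
  rewrite (stateC Sp) ler_piMl// addr_ge0//; exact: (state_ge0 Sp).
rewrite mulrC -mv -(stateZ Sm)//; apply: (state_le Sm) => // [|x].
  by apply: contM => //; exact: contC.
rewrite mulrC ler_wpM2r// -[leRHS](stateC Sn); apply: (state_le Sn) => //.
- exact: section_cont.
- exact: contC.
Qed.

End PerturbedCoupling.

(** * From measures of sets to integrals of continuous functions; limits of optimal couplings *)

Section Bridge.
Context {R : realType}.

(** The definitions speak of Borel sets, while only identities between integrals of continuous
    functions survive weak limits; this translates between the two. *)
Lemma pushforward_eqP (S T : ptopologicalType) (d : T -> T -> R)
    (P : probability (borel S) R) (Q : probability (borel T) R) (h : S -> T) :
  compact [set: S] -> compact [set: T] -> cdist d -> continuous h ->
  (forall A : set (borel T), measurable A -> P (h @^-1` A) = Q A) <->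
  (forall f, continuous f -> \int[P]_x f (h x) = \int[Q]_x f x).
Proof.
move=> Sc Tc dd ch; have [Q' [Q'A Q'f]] := pushforward_probability Sc P ch.
split=> [H f cf|H A mA].
  rewrite -Q'f// /Rintegral; congr fine; apply: eq_measure_integral => A mA _.
  by transitivity (P (h @^-1` A)); [exact: Q'A|exact: H].
rewrite -Q'A; apply: (probability_eq Tc dd) => // f cf.
by rewrite Q'f// H.
Qed.

Context {X Y : ptopologicalType} (Xc : compact [set: X]) (Yc : compact [set: Y]).
Context (dX : X -> X -> R) (dY : Y -> Y -> R) (ddX : cdist dX) (ddY : cdist dY).

Definition coupling_of (P : probability (borel (X * Y)%type) R)
    (mu : probability (borel X) R) (nu : probability (borel Y) R) : Prop :=
  coupled (fun f => \int[P]_x f x) (fun f => \int[mu]_x f x) (fun f => \int[nu]_x f x).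

Lemma has_marginalsP (P : probability (borel (X * Y)%type) R) mu nu :
  has_marginals P mu nu <-> coupling_of P mu nu.
Proof.
have cXY := compact_prod Xc Yc.
have c1 : continuous (@fst X Y) by move=> z; exact: cvg_fst.
have c2 : continuous (@snd X Y) by move=> z; exact: cvg_snd.
have [A1 A2] := pushforward_eqP P mu cXY Xc ddX c1.
have [B1 B2] := pushforward_eqP P nu cXY Yc ddY c2.
split=> -[H1 H2]; split; first exact: A1.
- exact: B1.
- exact: A2.
- exact: B2.
Qed.

Definition optimal (c : X * Y -> R) (P : probability (borel (X * Y)%type) R)
    (mu : probability (borel X) R) (nu : probability (borel Y) R) : Prop :=
  coupling_of P mu nu /\
  forall Q, coupling_of Q mu nu -> \int[P]_z c z <= \int[Q]_z c z.

Lemma optimal_couplingP (c : X * Y -> R) (P : probability (borel (X * Y)%type) R) mu nu :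
  continuous c -> optimal_coupling c mu nu P <-> optimal c P mu nu.
Proof.
move=> cc; have cXY := compact_prod Xc Yc.
split=> -[/has_marginalsP H1 H2]; split => // Q /has_marginalsP HQ.
  by have := H2 Q HQ; rewrite !EFin_expectation// lee_fin.
by rewrite !EFin_expectation// lee_fin; exact: H2.
Qed.

Lemma optimal_limit (c : X * Y -> R) (U : set_system nat)
    (mu : nat -> probability (borel X) R) (l : probability (borel X) R)
    (nu : probability (borel Y) R) (P : nat -> probability (borel (X * Y)%type) R)
    (v : R) (Q : probability (borel (X * Y)%type) R) :
  ProperFilter U -> continuous c -> (forall z, 0 <= c z) ->
  (forall f, continuous f -> \int[mu n]_x f x @[n --> U] --> \int[l]_x f x) ->
  (forall n, optimal c (P n) (mu n) nu) ->
  \int[P n]_z c z @[n --> U] --> v ->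
  coupling_of Q l nu -> v <= \int[Q]_z c z.
Proof.
move=> PU cc c0 mul optP Pv Qlnu; have cXY := compact_prod Xc Yc.
have Sl := expectation_state Xc l; have Sm n := expectation_state Xc (mu n).
have Sn := expectation_state Yc nu; have SQ := expectation_state cXY Q.
apply/ler_addgt0Pr => e e0.
have [M M0 cM] := compact_bounded_fun cXY cc.
have cM' z : c z <= M by apply: le_trans (cM z); exact: ler_norm.
(* Each point of a bump is compared with its centre at cost [e/4], so two points of it differ by at
   most [e/2]; the other [e/2] pays for the defect of mass [t]. *)
have e40 : 0 < e / 4%:R by rewrite divr_gt0.
have e20 : 0 <= e / 2%:R by rewrite divr_ge0// ltW.
have [rho rho0 Hrho] := uniform_in_fst Xc Yc ddX cc e40.
have [s [phi [phic phi0 phi1 phir]]] := partition_of_unity Xc ddX rho0.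
have ce a x x' y : phi a x != 0 -> phi a x' != 0 -> `|c (x, y) - c (x', y)| <= e / 2%:R.
  move=> /phir ax /phir ax'; have := Hrho _ _ y ax; have := Hrho _ _ y ax'.
  rewrite !ltr_norml ler_norml => /andP[? ?] /andP[? ?].
  by apply/andP; split; lra.
(* The minimum with 1 keeps [r = 1 - t] nonnegative, and [M + 1] avoids dividing by zero when
   [M = 0]. *)
pose t := Num.min 1 (e / 2%:R / (M + 1)).
have M1 : 0 < M + 1 by lra.
have t0 : 0 < t by rewrite /t lt_min ltr01 divr_gt0// divr_gt0.
have t1 : t <= 1 by rewrite /t ge_min lexx.
have tM : t * M <= e / 2%:R.
  apply: (@le_trans _ _ (t * (M + 1))); first by rewrite ler_wpM2l ?(ltW t0)//; lra.
  by rewrite -ler_pdivlMr// /t ge_min lexx orbT.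
have near_good : \forall n \near U, forall a, a \in s ->
    (1 - t) * (\int[l]_x phi a x) <= \int[mu n]_x phi a x.
  apply: near_all_seq => a.
  (* Convergence gives the bound only if [(1 - t) * l (phi a)] is strictly below the limit
     [l (phi a)], which fails when the latter is 0. *)
  have [l0|l0] := eqVneq (\int[l]_x phi a x) 0.
    by apply: nearW => n; rewrite l0 mulr0; exact: (state_ge0 (Sm n)).
  have lpos : 0 < \int[l]_x phi a x.
    by rewrite lt_neqAle eq_sym l0; exact: (state_ge0 Sl).
  have lt1 : (1 - t) * (\int[l]_x phi a x) < \int[l]_x phi a x.
    by rewrite mulrBl mul1r ltrBlDr ltrDl mulr_gt0.
  have nb := lt_le_nbhsr lt1.
  exact: (mul _ (phic a)) _ nb.
have le1 : \forall n \near U, \int[P n]_z c z <= \int[Q]_z c z + e.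
  apply: filterS near_good => n Hn.
  have r0 : 0 <= 1 - t by lra.
  have r1 : 1 - t <= 1 by lra.
  have [Q' EQ'] := riesz_representation cXY (prod_cdist ddX ddY)
    (perturbed_coupling_state Xc Yc (Sm n) Sn SQ Qlnu phic phi0 phi1 r0 Hn).
  have [q1 q2] := perturbed_coupling_coupled Xc Yc (Sm n) Sn SQ Qlnu phic phi0 phi1 r0 Hn.
  have [_ /(_ Q')] := optP n.
  have Q'c : coupling_of Q' (mu n) nu.
    split=> [f cf|g cg]; rewrite EQ'.
    - exact: q1.
    - by apply: cont_comp => // z; exact: cvg_fst.
    - exact: q2.
    - by apply: cont_comp => // z; exact: cvg_snd.
  move=> /(_ Q'c)/le_trans; apply; rewrite EQ'//.
  apply: le_trans (perturbed_coupling_cost Xc Yc (Sm n) Sn SQ Qlnu phic phi0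
    phi1 r0 r1 Hn cc c0 cM' e20 ce) _ => /=.
  by rewrite opprB addrCA subrr addr0; lra.
exact: (ler_cvg_to Pv (cvg_cst _) le1).
Qed.

End Bridge.

(** * Fixed points *)

(** Off a neighbourhood of [B y0], uniqueness makes [B y0] strictly better than any [x] at [y0].
    Compactness of the complement preserves this for all [y] near [y0], so [B y] cannot lie
    there. *)
Lemma argmin_continuous {R : realType} {X Y : ptopologicalType}
    (c : X * Y -> R) (B : Y -> X) :
  compact [set: X] -> continuous c ->
  (forall y x, c (B y, y) <= c (x, y)) ->
  (forall y x, (forall x', c (x, y) <= c (x', y)) -> x = B y) ->
  continuous B.
Proof.
move=> Xc cc Bmin Buniq y0 W /nbhs_interior; rewrite nbhsE => -[V [oV VB] VW].
have cV : compact (~` V).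
  by apply: (@subclosed_compact _ _ [set: X]) => //; exact: open_closedC.
have c1 : continuous (fun z : X * Y => (B y0, z.2)).
  by move=> z; apply: cvg_pair; [exact: cvg_cst|exact: cvg_snd].
have cg : continuous (fun z : X * Y => c z - c (B y0, z.2)).
  by apply: contB => //; exact: cont_comp c1.
have : \forall y \near y0, ~` V `<=` [set x | c (B y0, y) < c (x, y)].
  apply: (compact_near_coveringP _).1 cV _ _
    (fun y x => c (B y0, y) < c (x, y)) _ _.
  move=> x Vx.
  have pos : 0 < c (x, y0) - c (B y0, y0).
    rewrite subr_gt0 ltNge; apply/negP => xB; apply: Vx.
    by rewrite (Buniq y0 x)// => x'; apply: le_trans xB (Bmin _ _).
  have nb := lt_nbhsr pos.
  have := cg (x, y0) _ nb; rewrite /nbhs /=.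
  by apply: filterS => -[x' y'] /=; rewrite /= subr_gt0.
apply: filterS => y H; suff VBy : V (B y) by exact: nbhs_singleton (VW _ VBy).
by apply: contrapT => nVBy; have := H _ nVBy; rewrite /= ltNge Bmin.
Qed.

Theorem theorem1 (R : realType) (K : nat)
  (X : pseudoPMetricType R) (Y : 'I_K -> pseudoPMetricType R)
  (X_haus : hausdorff_space X) (Y_haus : forall k, hausdorff_space (Y k))
  (X_cpt : compact [set: X]) (Y_cpt : forall k, compact [set: Y k])
  (c : forall k, X * Y k -> R)
  (c_ge0 : forall k z, 0 <= c k z)
  (c_cont : forall k, continuous (c k))
  (B : (prod_topology Y) -> X)
  (B_min : forall (y : prod_topology Y) (x : X),
      \sum_(k < K) c k (B y, y k) <= \sum_(k < K) c k (x, y k))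
  (B_uniq : forall (y : prod_topology Y) (x : X),
      (forall x' : X, \sum_(k < K) c k (x, y k) <= \sum_(k < K) c k (x', y k)) ->
      x = B y)
  (nontriv : exists (x : X) (y : prod_topology Y), x <> B y)
  (nu : forall k, probability (borel (Y k)) R)
  (mu : nat -> probability (borel X) R)
  (mu_step : forall t, inG c B nu (mu t) (mu t.+1)) :
  (exists phi : nat -> nat, {homo phi : m n / (m < n)%N} /\
     exists l : probability (borel X) R, weak_cvg (fun n => mu (phi n)) l) /\
  (forall (phi : nat -> nat) (l : probability (borel X) R),
     {homo phi : m n / (m < n)%N} ->
     weak_cvg (fun n => mu (phi n)) l -> inG c B nu l l).
Proof.
have ddX := pdist_cdist X_haus.
split; first exact: (probability_sequentially_compact X_cpt ddX).
move=> phi l phi_incr mul.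
have ddY k := pdist_cdist (Y_haus k).
have Yc := compact_prod_topology Y_cpt.
have ddZ := prod_cdist ddX (prod_topology_cdist ddY).
have Zc := compact_prod X_cpt Yc.
pose Z : ptopologicalType := (X * prod_topology Y)%type.
pose h k (z : Z) : X * Y k := (z.1, z.2 k).
pose hB k (z : Z) : X * Y k := (B z.2, z.2 k).
have fstc : continuous (fun z : Z => z.1) by move=> z; exact: cvg_fst.
have sndc : continuous (fun z : Z => z.2) by move=> z; exact: cvg_snd.
have coordc k : continuous (fun z : Z => z.2 k).
  by apply: (cont_comp (g := fun y : prod_topology Y => y k)) => //; exact: proj_continuous.
have hc k : continuous (h k).
  by move=> z; apply: cvg_pair; [exact: fstc|exact: coordc].
have Bc : continuous B.
  apply: (argmin_continuous (c := fun z : Z => \sum_k c k (h k z))) => //.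
  by apply: cont_sum => k; exact: cont_comp (c_cont k) (hc k).
have BZc : continuous (fun z : Z => B z.2) by exact: cont_comp Bc sndc.
have hBc k : continuous (hB k).
  by move=> z; apply: cvg_pair; [exact: BZc|exact: coordc].
pose C (z : Z) := \sum_k c k (h k z).
pose CB (z : Z) := \sum_k c k (hB k z).
have chc k : continuous (fun z => c k (h k z)) by exact: cont_comp (c_cont k) (hc k).
have chBc k : continuous (fun z => c k (hB k z)) by exact: cont_comp (c_cont k) (hBc k).
have Cc : continuous C by exact: cont_sum.
have CBc : continuous CB by exact: cont_sum.
have CBle z : CB z <= C z by exact: B_min.
(* [Gamma] in terms of genuine probabilities on the products [X * Y k]. *)
have GammaP m g : Gamma c nu m g <-> forall k, exists P : probability (borel (X * Y k)%type) R,
    (forall f, continuous f -> \int[P]_x f x = \int[g]_z f (h k z)) /\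
    optimal (c k) P m (nu k).
  have E k (P : probability (borel (X * Y k)%type) R) :
      (forall A : set (borel (X * Y k)%type), P A = g (h k @^-1` A)) ->
      pushforward g (fun z : Z => (z.1, z.2 k) : borel (X * Y k)%type) = P.
    by move=> H; apply/funext => A; rewrite H.
  split=> H k.
    have [P [PA Pf]] := pushforward_probability Zc g (hc k).
    exists P; split => //; have := H k; rewrite (E k P PA).
    exact: (optimal_couplingP X_cpt (Y_cpt k) ddX (ddY k) P m (nu k) (c_cont k)).1.
  have [P [PA Pf]] := pushforward_probability Zc g (hc k).
  rewrite (E k P PA).
  apply: (optimal_couplingP X_cpt (Y_cpt k) ddX (ddY k) P m (nu k) (c_cont k)).2.
  have [P' [P'f [[M1 M2] opt]]] := H k.
  have PP' f : continuous f -> \int[P]_x f x = \int[P']_x f x.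
    by move=> cf; rewrite P'f// Pf.
  split; first split=> [f cf|f cf].
  - rewrite PP'; first exact: M1.
    by apply: cont_comp => // z; exact: cvg_fst.
  - rewrite PP'; first exact: M2.
    by apply: cont_comp => // z; exact: cvg_snd.
  - by move=> Q /opt; rewrite (PP' _ (@c_cont k)).
have /choice[g Hg] t : exists g : probability (borel Z) R, Gamma c nu (mu t) g /\
    forall A : set (borel X), measurable A -> g ((fun z => B z.2) @^-1` A) = mu t.+1 A.
  by have [g [Gg gB]] := mu_step t; exists g; split => // A mA; rewrite gB.
have gG t := (GammaP _ _).1 (Hg t).1.
have gB t f : continuous f -> \int[g t]_z f (B z.2) = \int[mu t.+1]_x f x.
  move=> cf; apply: ((pushforward_eqP (g t) (mu t.+1) Zc X_cpt ddX BZc).1 _ f cf).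
  exact: (Hg t).2.
have Sg t := expectation_state Zc (g t).
pose S t := \int[g t]_z C z.
have SE t : S t = \sum_k \int[g t]_z c k (h k z) by rewrite /S (state_sum (Sg t)).
have S_CB t : S t.+1 <= \int[g t]_z CB z.
  rewrite SE (state_sum (Sg t))//; apply: ler_sum => k _.
  have [P [Pf [_ Popt]]] := gG t.+1 k; rewrite -(Pf _ (@c_cont k)).
  have [Q [_ Qf]] := pushforward_probability Zc (g t) (hBc k).
  rewrite -(Qf _ (@c_cont k)); apply: Popt; split => f cf.
    rewrite Qf; first exact: gB.
    by apply: cont_comp => // z; exact: cvg_fst.
  rewrite Qf; last by apply: cont_comp => // z; exact: cvg_snd.
  have [P' [P'f [[_ M2] _]]] := gG t k; rewrite -M2// P'f//.
  by apply: cont_comp => // z; exact: cvg_snd.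
have CB_S t : \int[g t]_z CB z <= S t by exact: (state_le (Sg t)).
have S0 t : 0 <= S t.
  by apply: (state_ge0 (Sg t)) => // z; apply: sumr_ge0 => k _; exact: c_ge0.
(* Monotonicity gives convergence of the whole sequence, not only along [phi]: the lower bound used
   below is [S (phi n).+1], at an index that [phi] may skip. *)
have [s Ss] : exists s : R, S t @[t --> \oo] --> s.
  have Sdec : {homo S : m n / (m <= n)%N >-> n <= m}.
    by apply/nonincreasing_seqP => t; exact: le_trans (S_CB t) (CB_S t).
  have Slb : has_lbound (range S) by exists 0 => _ [t _ <-].
  by exists (limn S); exact: (nonincreasing_is_cvgn Sdec Slb).
have phi_ge n : (n <= phi n)%N.
  by elim: n => // n ih; apply: leq_ltn_trans ih (phi_incr _ _ (ltnSn n)).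
have phioo : phi n @[n --> \oo] --> \oo.
  move=> A [N _ NA]; exists N => // n Nn; apply: NA => /=.
  exact: leq_trans Nn (phi_ge n).
have phi1oo : (phi n).+1 @[n --> \oo] --> \oo.
  move=> A [N _ NA]; exists N => // n Nn; apply: NA => /=.
  exact: leqW (leq_trans Nn (phi_ge n)).
have [U [UU ooU]] := ultraFilterLemma (@eventually_filter).
have PU : ProperFilter U by exact: ultra_proper.
have toU (u : nat -> R) a : u n @[n --> \oo] --> a -> u n @[n --> U] --> a.
  by move=> ua A /ua; exact: ooU.
have Sphi : S (phi n) @[n --> U] --> s by apply: toU; exact: (cvg_comp _ _ phioo Ss).
have CBphi : \int[g (phi n)]_z CB z @[n --> U] --> s.
  apply: toU; apply: (squeeze_cvgr _ (cvg_comp _ _ phi1oo Ss) (cvg_comp _ _ phioo Ss)).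
  by apply: nearW => n /=; rewrite S_CB CB_S.
have mulU f : continuous f -> \int[mu (phi n)]_x f x @[n --> U] --> \int[l]_x f x.
  move=> cf; apply: toU; have [M _ fM] := compact_bounded_fun X_cpt cf.
  have := mul f cf (ex_intro _ M fM); rewrite EFin_expectation//.
  by move=> /fine_cvg.
have Sgphi n := Sg (phi n).
have [gam Egam] := riesz_representation Zc ddZ (ultralim_state UU Zc Sgphi).
(* The first marginal of [g t] is known only through its couplings with the [nu k], hence the need
   for some index [k0]. *)
have gaml (k0 : 'I_K) f : continuous f -> \int[gam]_z f z.1 = \int[l]_x f x.
  move=> cf; have cf1 : continuous (fun z : Z => f z.1) by exact: cont_comp cf fstc.
  rewrite Egam//; apply: (ultralimE UU).
  have -> : (fun n => \int[g (phi n)]_z f z.1) = fun n => \int[mu (phi n)]_x f x.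
    apply/funext => n; have [P [Pf [[M1 _] _]]] := gG (phi n) k0.
    by rewrite -M1// Pf//; apply: cont_comp => // z; exact: cvg_fst.
  exact: mulU.
have HP k : exists P : nat -> probability (borel (X * Y k)%type) R, forall n,
    (forall f, continuous f -> \int[P n]_x f x = \int[g (phi n)]_z f (h k z)) /\
    optimal (c k) (P n) (mu (phi n)) (nu k).
  by have /choice[P ?] := fun n => gG (phi n) k; exists P.
have gamnu k f : continuous f -> \int[gam]_z f (z.2 k) = \int[nu k]_x f x.
  move=> cf; have cfk : continuous (fun z : Z => f (z.2 k)) by exact: cont_comp cf (coordc k).
  rewrite Egam//; apply: (ultralimE UU).
  have -> : (fun n => \int[g (phi n)]_z f (z.2 k)) = fun=> \int[nu k]_x f x.
    apply/funext => n; have [P [Pf [[_ M2] _]]] := gG (phi n) k.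
    by rewrite -M2// Pf//; apply: cont_comp => // z; exact: cvg_snd.
  exact: cvg_cst.
exists gam; split.
  apply/GammaP => k; have [Pk [_ Pkf]] := pushforward_probability Zc gam (hc k).
  exists Pk; split => //; split; first split=> [f cf|f cf].
  - rewrite Pkf; first exact: gaml.
    by apply: cont_comp => // z; exact: cvg_fst.
  - rewrite Pkf; first exact: gamnu.
    by apply: cont_comp => // z; exact: cvg_snd.
  - move=> Q Ql; have [P HPk] := HP k; rewrite (Pkf _ (@c_cont k)).
    have lim : \int[P n]_z c k z @[n --> U] --> \int[gam]_z c k (h k z).
      rewrite Egam//.
      have -> : (fun n => \int[P n]_z c k z) = fun n => \int[g (phi n)]_z c k (h k z).
        by apply/funext => n; rewrite (HPk n).1.
      exact: (ultralim_cvg UU Zc Sgphi).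
    exact: (optimal_limit X_cpt (Y_cpt k) ddX (ddY k) PU (c_cont k) (c_ge0 k) mulU
      (fun n => (HPk n).2) lim Ql).
(* For [K = 0] all total costs are empty sums, so every [x] is a minimiser and equals [B y], against
   [nontriv]. *)
have [k0 _] : exists k : 'I_K, True.
  have [k _|K0] := pickP (fun _ : 'I_K => true); first by exists k.
  have [x [y xy]] := nontriv; exfalso; apply: xy; apply: B_uniq => x'.
  by rewrite !big1// => k; have := K0 k.
move=> A mA; apply/esym; move: A mA.
apply: (pushforward_eqP gam l Zc X_cpt ddX BZc).2 => f cf.
rewrite -(gaml k0 f cf).
have Sgam := expectation_state Zc gam.
pose D z := C z - CB z.
have Dc : continuous D by exact: contB.
(* [D] is nonnegative with integral [s - s = 0]. *)
have ae0 : ae_eq gam [set: borel Z] (EFin \o D) (cst 0%E).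
  apply/(ae_eq_integral_abs gam measurableT (continuous_borelE Dc)).
  have -> : (fun z : borel Z => `|(EFin \o D) z|%E) = fun z => (D z)%:E.
    by apply/funext => z /=; rewrite ger0_norm// subr_ge0.
  rewrite EFin_expectation// (stateB Sgam)// !Egam//.
  by rewrite (ultralimE UU Sphi) (ultralimE UU CBphi) subrr.
have cf1 : continuous (fun z : Z => f z.1) by exact: cont_comp cf fstc.
have cfB : continuous (fun z : Z => f (B z.2)) by exact: cont_comp cf BZc.
rewrite /Rintegral; congr fine; apply: ae_eq_integral => //.
- exact: (continuous_borelE cfB).
- exact: (continuous_borelE cf1).
apply: filterS ae0 => z /= H zT; have /= [CE] := H zT.
congr (f _)%:E; apply/esym; apply: B_uniq => x'.
apply: le_trans (B_min z.2 x').
by rewrite -subr_le0; change (D z <= 0); rewrite CE.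
Qed.
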